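(* The $K$-representation $V_{(m,n,\max\{n,m\})}$ is irreducible for each (integer) $m>M$ and $n>N$.
   Context: Let $k$ be a $p$-adic field of characteristic $0$ with residual characteristic $p>2$ and residue field of order $q>3$; $\mathcal R$ its integer ring, $\mathfrak p$ the maximal ideal. $K=\mathrm{GL}(3,\mathcal R)$. Let $\chi_2,\chi_3$ be restrictions to $\mathcal R^\times$ of characters of $k^\times$. The conductor $\mathrm{cond}(\psi)$ is the least $m\ge0$ with $1+\mathfrak p^m\subseteq\ker\psi$, with the convention that $\mathrm{cond}(\psi)=0$ iff $\psi|_{\mathcal R^\times}=\mathbf 1$. Put $M=\mathrm{cond}(\chi_2)$, $N=\mathrm{cond}(\chi_3)$ and assume $0\le M\le N$, $N>0$, and $\mathrm{cond}(\chi_2\chi_3^{-1})=N$. Let $\mathbf m=(M,N,N)$. $\mathtt T=\{\mathbf c=(c_1,c_2,c_3)\in\mathbb Z^3:0\le c_1,c_2\le c_3\le c_1+c_2\}$, partially ordered componentwise; $\mathtt T_{\mathbf m}=\{\mathbf c\in\mathtt T:\mathbf c\succeq\mathbf m\}$. $C_{\mathbf c}$ is the subgroup of $g=(g_{ij})\in K$ with $g_{21}\in\mathfrak p^{c_1}$, $g_{32}\in\mathfrak p^{c_2}$, $g_{31}\in\mathfrak p^{c_3}$. For $\mathbf c\in\mathtt T_{\mathbf m}$, $\chi_{\mathbf c}(g)=\chi_2(g_{22})\chi_3(g_{33})$ is a character of $C_{\mathbf c}$ (the factor $\chi_2(g_{22})$ is read as $1$ if $M=0$), and $U_{\mathbf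 c}=\mathrm{Ind}_{C_{\mathbf c}}^K\chi_{\mathbf c}$. All $U_{\mathbf c}$ are regarded as subrepresentations of $\mathrm{Ind}_B^K\chi$, where $B$ is the upper triangular subgroup of $K$ and $\chi$ is the character of $B$ given by $b\mapsto\chi_2(b_{22})\chi_3(b_{33})$; then $U_{\mathbf d}\subseteq U_{\mathbf c}$ when $\mathbf d\preceq\mathbf c$. Set $V_{\mathbf c}=U_{\mathbf c}\big/\sum_{\mathbf d\in\mathtt T_{\mathbf m},\,\mathbf d\prec\mathbf c}U_{\mathbf d}$. *)

(* Defs.v *)
From HB Require Import structures.
From mathcomp Require Import all_boot all_order all_algebra.
From mathcomp Require Import ring_quotient.
From mathcomp Require Import boolp functions reals.

Set Implicit Arguments.
Unset Strict Implicit.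
Unset Printing Implicit Defensive.

Import Order.TTheory GRing.Theory Num.Theory.
Local Open Scope ring_scope.

(** * Representations of an abstract group on vector spaces over F *)

Record representation (G : groupType) (F : fieldType) := Representation {
  rep_space :> lmodType F;
  rep_act : G -> rep_space -> rep_space;
  rep_linear : forall g, linear (rep_act g);
  rep_act1 : forall v, rep_act 1%g v = v;
  rep_actM : forall g h v, rep_act (g * h)%g v = rep_act g (rep_act h v)
}.

Record subrep (G : groupType) (F : fieldType) (V : representation G F) :=
  Subrep {
    subrep_pred :> {pred V};
    subrep_submod : submod_closed subrep_pred;
    subrep_act : forall g v, v \in subrep_pred -> rep_act g v \in subrep_pred
  }.

Definition irreducible_rep (G : groupType) (F : fieldType)
    (V : representation G F) : Prop :=
  (exists v : V, v != 0) /\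
  forall W : subrep V,
    (forall v, v \in W -> v = 0) \/ (forall v, v \in W).

Section SubQuotient.
Variables (G : groupType) (F : fieldType) (V : representation G F).

HB.instance Definition _ (W : subrep V) :=
  GRing.isSubmodClosed.Build F V (subrep_pred W)
    (GRing.submod_closed_semi (subrep_submod W)).

Section SubRep.
Variable W : subrep V.

Definition sub_space := {v : V | v \in W}.
HB.instance Definition _ := SubChoice.on sub_space.
HB.instance Definition _ := [SubChoice_isSubLmodule of sub_space by <:].

Definition sub_act (g : G) (v : sub_space) : sub_space :=
  Sub (rep_act g (val v)) (subrep_act g (valP v)).

Fact sub_linear g : linear (sub_act g).
Proof.
by move=> a u v; apply: val_inj; rewrite /= rep_linear.
Qed.

Fact sub_act1 v : sub_act 1%g v = v.
Proof. by apply: val_inj; exact: rep_act1. Qed.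

Fact sub_actM g h v : sub_act (g * h)%g v = sub_act g (sub_act h v).
Proof. by apply: val_inj; exact: rep_actM. Qed.

Definition rep_of_subrep : representation G F :=
  Representation sub_linear sub_act1 sub_actM.

End SubRep.

Section QuotRep.
Variable W : subrep V.
Local Open Scope quotient_scope.

Definition quot_space := Quotient.quot (subrep_pred W).
HB.instance Definition _ := GRing.Zmodule.on quot_space.
HB.instance Definition _ := EqQuotient.on quot_space.

Let quotE (u v : V) :
  (\pi_quot_space u = \pi_quot_space v) <-> (u - v \in W).
Proof.
by rewrite -[_ \in W]/(Quotient.equiv _ u v); split=> [/eqmodP|?] //; exact/eqmodP.
Qed.

Let piD (u v : V) :
  \pi_quot_space u + \pi_quot_space v = \pi_quot_space (u + v).
Proof. by rewrite [RHS]Quotient.pi_add. Qed.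

Definition quot_scale (a : F) (x : quot_space) : quot_space :=
  \pi_quot_space (a *: (repr x : V)).

Let pi_scale a (v : V) :
  quot_scale a (\pi_quot_space v) = \pi_quot_space (a *: v).
Proof.
by apply/quotE; rewrite -scalerBr rpredZ //; apply/quotE; rewrite reprK.
Qed.

Fact quot_scaleA a b x : quot_scale a (quot_scale b x) = quot_scale (a * b) x.
Proof. by rewrite -[x]reprK (pi_scale b) !pi_scale scalerA. Qed.

Fact quot_scale1 : left_id 1 quot_scale.
Proof. by move=> x; rewrite -[x]reprK pi_scale scale1r. Qed.

Fact quot_scaleDr : right_distributive quot_scale +%R.
Proof.
by move=> a x y; rewrite -[x]reprK -[y]reprK piD !pi_scale piD scalerDr.
Qed.

Fact quot_scaleDl x : {morph quot_scale^~ x : a b / a + b}.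
Proof. by move=> a b; rewrite -[x]reprK !pi_scale piD scalerDl. Qed.

HB.instance Definition _ := GRing.Zmodule_isLmodule.Build F quot_space
  quot_scaleA quot_scale1 quot_scaleDr quot_scaleDl.

Let piZ a (v : V) :
  a *: (\pi_quot_space v : quot_space) = \pi_quot_space (a *: v).
Proof. exact: pi_scale. Qed.

Definition quot_act (g : G) (x : quot_space) : quot_space :=
  \pi_quot_space (rep_act g (repr x)).

Let pi_act g (v : V) :
  quot_act g (\pi_quot_space v) = \pi_quot_space (rep_act g v).
Proof.
have actB (u w : V) : rep_act g u - rep_act g w = rep_act g (u - w).
  have := rep_linear g (-1) w u.
  by rewrite !scaleN1r addrC => <-; rewrite addrC.
by apply/quotE; rewrite actB subrep_act //; apply/quotE; rewrite reprK.
Qed.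

Fact quot_linear g : linear (quot_act g).
Proof.
move=> a x y; rewrite -[x]reprK -[y]reprK piZ piD !pi_act rep_linear.
by rewrite piZ piD.
Qed.

Fact quot_act1 x : quot_act 1%g x = x.
Proof. by rewrite -[x]reprK pi_act rep_act1. Qed.

Fact quot_actM g h x : quot_act (g * h)%g x = quot_act g (quot_act h x).
Proof. by rewrite -[x]reprK (pi_act h) !pi_act rep_actM. Qed.

Definition quot_rep : representation G F :=
  Representation quot_linear quot_act1 quot_actM.

End QuotRep.

Section Sum.
Variables (I : Type) (P : I -> Prop) (U : I -> subrep V).

Definition sum_pred : {pred V} := fun v =>
  `[< exists2 s : seq V,
        (forall u, u \in s -> exists2 i, P i & u \in U i)
      & v = \sum_(u <- s) u >].

Fact sum_submod : submod_closed sum_pred.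
Proof.
split=> [|a u v].
  by apply/asboolP; exists [::]; rewrite ?big_nil.
move=> /asboolP[s sU ->] /asboolP[t tU ->]; apply/asboolP.
exists ([seq a *: w | w <- s] ++ t); last first.
  by rewrite big_cat big_map scaler_sumr.
move=> w; rewrite mem_cat => /orP[/mapP[z zs ->]|/tU//].
by have [i Pi zi] := sU _ zs; exists i; rewrite // rpredZ.
Qed.

Fact sum_act g v : v \in sum_pred -> rep_act g v \in sum_pred.
Proof.
move=> /asboolP[s sU ->]; apply/asboolP.
exists [seq rep_act g w | w <- s].
  move=> w /mapP[z zs ->]; have [i Pi zi] := sU _ zs.
  by exists i; rewrite // subrep_act.
have act0 : rep_act g (0 : V) = 0.
  by have /eqP := rep_linear g 1 (0 : V) 0;
     rewrite !scale1r addr0 -subr_eq0 opprD addNKr oppr_eq0 => /eqP.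
rewrite big_map; elim: s {sU} => [|w s IHs]; first by rewrite !big_nil.
rewrite !big_cons -IHs.
by have := rep_linear g 1 w (\sum_(u <- s) u); rewrite !scale1r.
Qed.

Definition sum_subrep : subrep V := Subrep sum_submod sum_act.

End Sum.

Section Restrict.
Variables (W S : subrep V).

Definition restrict_pred : {pred rep_of_subrep W} := fun v => val v \in S.

Let restrictE v : (v \in restrict_pred) = (val v \in S).
Proof. by []. Qed.

Fact restrict_submod : submod_closed restrict_pred.
Proof.
split=> [|a u v]; rewrite !restrictE /=; first exact: rpred0.
by move=> uS vS; rewrite rpredD // rpredZ.
Qed.

Fact restrict_act g v :
  v \in restrict_pred -> rep_act g v \in restrict_pred.
Proof. by rewrite !restrictE; exact: subrep_act. Qed.

(* S \cap W as a subrepresentation of W. *)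
Definition restrict_subrep : subrep (rep_of_subrep W) :=
  Subrep restrict_submod restrict_act.

End Restrict.
End SubQuotient.

(** * The general linear group of a commutative ring *)

Definition GL (n : nat) (A : comUnitRingType) := {g : 'M[A]_n | g \in unitmx}.

Section GLGroup.
Variables (n : nat) (A : comUnitRingType).
HB.instance Definition _ := SubChoice.on (GL n A).

Definition GL_one : GL n A := Sub 1%:M (unitmx1 A n).

Fact GL_mul_subproof (g h : GL n A) : val g *m val h \in unitmx.
Proof. by rewrite unitmx_mul (valP g) (valP h). Qed.
Definition GL_mul (g h : GL n A) : GL n A := 
  Sub (val g *m val h) (GL_mul_subproof g h).

Fact GL_inv_subproof (g : GL n A) : invmx (val g) \in unitmx.
Proof. by rewrite unitmx_inv (valP g). Qed.
Definition GL_inv (g : GL n A) : GL n A := 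
  Sub (invmx (val g)) (GL_inv_subproof g).

Fact GL_mulA : associative GL_mul.
Proof. by move=> f g h; apply: val_inj; exact: mulmxA. Qed.
Fact GL_mul1 : left_id GL_one GL_mul.
Proof. by move=> g; apply: val_inj; exact: mul1mx. Qed.
Fact GL_mulr1 : right_id GL_one GL_mul.
Proof. by move=> g; apply: val_inj; exact: mulmx1. Qed.
Fact GL_mulV : left_inverse GL_one GL_inv GL_mul.
Proof. by move=> g; apply: val_inj; exact: mulVmx (valP g). Qed.
Fact GL_mulrV : right_inverse GL_one GL_inv GL_mul.
Proof. by move=> g; apply: val_inj; exact: mulmxV (valP g). Qed.

HB.instance Definition _ := isGroup.Build (GL n A)
  GL_mulA GL_mul1 GL_mulr1 GL_mulV GL_mulrV.
End GLGroup.

(** * p-adic fields *)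

(* The value of [dv] at 0 (mathematically +oo) is irrelevant. *)
Record discretelyValuedField := DiscretelyValuedField {
  dv_field :> fieldType;
  dv : dv_field -> int;
  dvM : forall x y, x != 0 -> y != 0 -> dv (x * y) = dv x + dv y;
  dvD : forall x y, x != 0 -> y != 0 -> x + y != 0 ->
    Num.min (dv x) (dv y) <= dv (x + y);
  dv_uniformizer : exists2 pi, pi != 0 & dv pi = 1
}.

Section IntegerRing.
Variable k : discretelyValuedField.

(* The fractional ideal p^n, as a subset of k; p^0 is the integer ring. *)
Definition idealpow (n : nat) : {pred k} :=
  fun x => (x == 0) || (n%:Z <= dv x).

Lemma dv1 : dv (1 : k) = 0.
Proof.
have /eqP := @dvM k 1 1 (oner_neq0 _) (oner_neq0 _).
by rewrite mulr1 -subr_eq0 opprD addNKr oppr_eq0 => /eqP.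
Qed.

Lemma dvN1 : dv (- 1 : k) = 0.
Proof.
have N0 : - 1 != 0 :> k by rewrite oppr_eq0 oner_neq0.
have := dvM N0 N0; rewrite mulrNN mulr1 dv1 -mulr2n => /esym/eqP.
by rewrite mulrn_eq0 => /eqP.
Qed.

Lemma dvV (x : k) : x != 0 -> dv x^-1 = - dv x.
Proof.
move=> x0; apply/eqP; rewrite -addr_eq0 -dvM ?invr_eq0 //.
by rewrite mulVf // dv1.
Qed.

Lemma idealpow0 n : 0 \in idealpow n.
Proof. by rewrite unfold_in /= eqxx. Qed.

Lemma idealpowM n x y :
  x \in idealpow n -> y \in idealpow 0 -> x * y \in idealpow n.
Proof.
rewrite !unfold_in /= mulf_eq0.
have [//|x0 /= xi] := eqVneq x 0; have [//|y0 /= yi] := eqVneq y 0.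
by rewrite dvM // -[n%:Z]addr0 lerD.
Qed.

Lemma idealpowD n x y :
  x \in idealpow n -> y \in idealpow n -> x + y \in idealpow n.
Proof.
rewrite !unfold_in /=; have [->|x0 /= xi] := eqVneq x 0.
  by rewrite add0r.
have [->|y0 /= yi] := eqVneq y 0; first by rewrite addr0 xi orbT.
have [//|xy0 /=] := eqVneq (x + y) 0.
by apply: le_trans (dvD x0 y0 xy0); rewrite le_min xi yi.
Qed.

Lemma idealpow_sum n (I : finType) (E : I -> k) :
  (forall i, E i \in idealpow n) -> \sum_i E i \in idealpow n.
Proof.
by move=> En; elim/big_ind: _ => [|x y|//]; [exact: idealpow0|exact: idealpowD].
Qed.

Fact integers_subring : subring_closed (idealpow 0).
Proof.
have i1 : (1 : k) \in idealpow 0 by rewrite unfold_in /= dv1 lexx orbT.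
have iN1 : (-1 : k) \in idealpow 0 by rewrite unfold_in /= dvN1 lexx orbT.
split=> // x y xi yi; last exact: idealpowM.
by rewrite -mulN1r; apply: idealpowD => //; exact: idealpowM.
Qed.

HB.instance Definition _ :=
  GRing.isSubringClosed.Build k (idealpow 0) integers_subring.

Definition integers := {x : k | x \in idealpow 0}.
HB.instance Definition _ := SubChoice.on integers.
HB.instance Definition _ := [SubChoice_isSubComNzRing of integers by <:].

Definition integers_unit : {pred integers} :=
  fun x => (val x != 0) && (dv (val x) == 0).

Definition integers_inv (x : integers) : integers :=
  if x \in integers_unit then insubd x (val x)^-1 else x.

Fact integers_mulVx :
  {in integers_unit, left_inverse 1 integers_inv *%R}.
Proof.
move=> x xu; rewrite /integers_inv xu; apply: val_inj.
move: xu; rewrite unfold_in => /andP[x0 /eqP vx].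
rewrite /= val_insubd unfold_in /= dvV // vx oppr0 lexx orbT /=.
by rewrite mulVf.
Qed.

Fact integers_unitPl (x y : integers) : y * x = 1 -> integers_unit x.
Proof.
move=> /(congr1 val); rewrite /= => yx.
have [x0 y0] : val x != 0 /\ val y != 0.
  by split; apply: contra_eq_neq yx => ->; rewrite ?mulr0 ?mul0r eq_sym oner_neq0.
rewrite /integers_unit x0 /=.
have := dvM y0 x0; rewrite yx dv1 => /esym/eqP; rewrite paddr_eq0.
- by case/andP.
- by have := valP y; rewrite unfold_in (negPf y0).
- by have := valP x; rewrite unfold_in (negPf x0).
Qed.

Fact integers_inv_out : {in [predC integers_unit], integers_inv =1 id}.
Proof. by move=> x; rewrite inE /= /integers_inv => /negPf->. Qed.

HB.instance Definition _ := GRing.ComNzRing_hasMulInverse.Build integers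
  integers_mulVx integers_unitPl integers_inv_out.

End IntegerRing.

(* A complete discretely valued field of characteristic 0 with finite residue
   field; the latter is given as a finite field onto which the integer ring
   surjects with kernel the maximal ideal. *)
Record padicField := PadicField {
  padic_field :> discretelyValuedField;
  padic_char0 : [pchar padic_field] =i pred0;
  padic_complete : forall u : nat -> padic_field,
    (forall n, exists N, forall i j,
       (N <= i)%N -> (N <= j)%N -> u i - u j \in idealpow n) ->
    exists l, forall n, exists N, forall i,
       (N <= i)%N -> u i - l \in idealpow n;
  residue_field : finFieldType;
  residue : {rmorphism integers padic_field -> residue_field};
  residue_surj : forall y, exists x, residue x = y;
  residue_ker : forall x,
    residue x = 0 <-> val x \in idealpow 1
}.

Section Characters.
Variables (k : padicField) (F : fieldType).

(* The filtration subgroup of level m of the units: R^* if m = 0, and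
   1 + p^m if m > 0. *)
Definition unit_filtration (m : nat) : {pred k} :=
  fun x => [&& x != 0, dv x == 0 & x - 1 \in idealpow m].

(* Characters of k^*, i.e. homomorphisms to F^* with open kernel; the value at
   0 is irrelevant. *)
Definition is_character (psi : k -> F) : Prop :=
  [/\ forall x, x != 0 -> psi x != 0,
      forall x y, x != 0 -> y != 0 -> psi (x * y) = psi x * psi y
    & exists m, forall x, x \in unit_filtration m -> psi x = 1].

Definition is_cond (psi : k -> F) (m : nat) : Prop :=
  (forall x, x \in unit_filtration m -> psi x = 1) /\
  (forall m', (forall x, x \in unit_filtration m' -> psi x = 1) ->
     (m <= m')%N).

End Characters.

(** * Smooth induction for K = GL(3, R) *)

Notation GL3 k := (GL 3 (integers k)).

Section Induction.
Variables (k : padicField) (F : fieldType).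
Notation K := (GL3 k).

(* Matrix indices start at 0: the usual g_21 is [entry g 1 0]. *)
Definition entry (g : K) (i j : 'I_3) : k := val (val g i j).

(* The functions K -> F with K acting by right translation. *)
Definition rtrans (g : K) (f : K -> F^o) : K -> F^o := fun x => f (x * g)%g.

Fact rtrans_linear g : linear (rtrans g).
Proof. by []. Qed.
Fact rtrans1 f : rtrans 1%g f = f.
Proof. by apply/funext => x; rewrite /rtrans mulg1. Qed.
Fact rtransM g h f : rtrans (g * h)%g f = rtrans g (rtrans h f).
Proof. by apply/funext => x; rewrite /rtrans mulgA. Qed.

Definition fun_rep : representation K F :=
  @Representation K F (K -> F^o) rtrans rtrans_linear rtrans1 rtransM.

(* The principal congruence subgroups: a basis of neighbourhoods of 1. *)
Definition congruence_subgroup (n : nat) : {pred K} :=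
  fun g => [forall i, forall j, entry g i j - (i == j)%:R \in idealpow n].

Lemma congruence_subgroup_le m n g : (m <= n)%N ->
  g \in congruence_subgroup n -> g \in congruence_subgroup m.
Proof.
move=> mn /forallP gn; apply/forallP => i; apply/forallP => j.
have := forallP (gn i) j; rewrite !unfold_in => /orP[->//|nd].
by apply/orP; right; apply: le_trans nd; rewrite lez_nat.
Qed.

Lemma congruence_subgroup_conj n (g h : K) :
  h \in congruence_subgroup n -> (g^-1 * h * g)%g \in congruence_subgroup n.
Proof.
have entryB (x : K) i j :
    entry x i j - (i == j)%:R = val ((val x - 1%:M) i j).
  by rewrite !mxE rmorphB rmorph_nat.
move=> /forallP hn; apply/forallP => i; apply/forallP => j.
have -> : entry (g^-1 * h * g)%g i j - (i == j)%:R =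
    \sum_a (\sum_b (entry h b a - (b == a)%:R) * entry g^-1%g i b) * entry g a j.
  have gE : val (g^-1 * h * g)%g - 1%:M =
      val g^-1%g *m (val h - 1%:M) *m val g.
    by rewrite mulmxBr mulmx1 mulmxBl -[val g^-1%g *m val g]/(val (g^-1 * g)%g) mulVg.
  rewrite entryB gE mxE rmorph_sum; apply: eq_bigr => a _.
  rewrite mxE rmorphM rmorph_sum; congr (_ * _); apply: eq_bigr => b _.
  by rewrite rmorphM mulrC entryB.
apply: idealpow_sum => a; apply: idealpowM; last exact: valP (val g a j).
apply: idealpow_sum => b; apply: idealpowM; last exact: valP (val g^-1%g i b).
exact: forallP (hn b) a.
Qed.

Definition smooth (f : K -> F) : Prop :=
  exists n, forall x g, g \in congruence_subgroup n -> f (x * g)%g = f x.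

Variables (H : {pred K}) (psi : K -> F).

Definition Ind_pred : {pred fun_rep} := fun f =>
  `[< (forall h x, h \in H -> f (h * x)%g = psi h * f x) /\ smooth f >].

Fact Ind_submod : submod_closed Ind_pred.
Proof.
split=> [|a f1 f2].
  apply/asboolP; split; last by exists 0%N.
  by move=> h x _; rewrite -[RHS]/(psi h * 0) mulr0.
move=> /asboolP[f1H [n1 f1S]] /asboolP[f2H [n2 f2S]]; apply/asboolP; split.
  move=> h x hH; rewrite /= -[LHS]/(a * f1 (h * x)%g + f2 (h * x)%g).
  by rewrite f1H // f2H // -[RHS]/(psi h * (a * f1 x + f2 x)) mulrDr mulrCA.
exists (maxn n1 n2) => x g gn.
rewrite -[LHS]/(a * f1 (x * g)%g + f2 (x * g)%g).
by rewrite f1S ?f2S // (congruence_subgroup_le _ gn) ?leq_maxl ?leq_maxr.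
Qed.

Fact Ind_act g f : f \in Ind_pred -> rep_act g f \in Ind_pred.
Proof.
move=> /asboolP[fH [n fS]]; apply/asboolP; split.
  move=> h x hH; rewrite -[LHS]/(f (h * x * g)%g) -[rep_act g f x]/(f (x * g)%g).
  by rewrite -mulgA; exact: fH.
exists n => x h hn.
rewrite -[LHS]/(f (x * h * g)%g) -[RHS]/(f (x * g)%g).
rewrite -(fS (x * g)%g (g^-1 * h * g)%g) ?congruence_subgroup_conj //.
by rewrite !mulgA -[(x * g * _)%g]mulgA mulgV mulg1.
Qed.

Definition Ind : subrep fun_rep := Subrep Ind_submod Ind_act.

End Induction.

Section Vc.
Variables (k : padicField) (F : fieldType) (chi2 chi3 : k -> F) (M N : nat).
Notation K := (GL3 k).

(* A triple in Z^3 all of whose coordinates are >= 0. *)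
Record triple := Triple { tr1 : nat; tr2 : nat; tr3 : nat }.

Definition triple_le (d c : triple) : Prop :=
  [/\ (tr1 d <= tr1 c)%N, (tr2 d <= tr2 c)%N & (tr3 d <= tr3 c)%N].

Definition triple_lt (d c : triple) : Prop := triple_le d c /\ d <> c.

Definition in_T (c : triple) : Prop :=
  [/\ (tr1 c <= tr3 c)%N, (tr2 c <= tr3 c)%N
    & (tr3 c <= tr1 c + tr2 c)%N].

Definition in_Tm (c : triple) : Prop := in_T c /\ triple_le (Triple M N N) c.

Definition C_ (c : triple) : {pred K} := fun g =>
  [&& entry g 1 0 \in idealpow (tr1 c), entry g 2 1 \in idealpow (tr2 c)
    & entry g 2 0 \in idealpow (tr3 c)].

(* If M = 0, g_22 need not be a unit on C_c, and the factor chi2 g_22 is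
   read as 1. *)
Definition chi_c (g : K) : F :=
  (if M == 0%N then 1 else chi2 (entry g 1 1)) * chi3 (entry g 2 2).

(* Ind_{C_c}^K chi_c, realised inside the functions on K and hence inside
   Ind_B^K chi (U_sub_IndB).  Smoothness is automatic for c in T_m. *)
Definition U_ (c : triple) : subrep (fun_rep k F) := Ind (C_ c) chi_c.

Definition borel : {pred K} := fun g =>
  [&& entry g 1 0 == 0, entry g 2 1 == 0 & entry g 2 0 == 0].

Definition chi_B (b : K) : F := chi2 (entry b 1 1) * chi3 (entry b 2 2).

(* By U_mono the sum is contained in U_c, so restricting it to U_c loses
   nothing. *)
Definition V_ (c : triple) : representation K F :=
  quot_rep (restrict_subrep (U_ c)
    (sum_subrep (fun d => in_Tm d /\ triple_lt d c) U_)).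

Lemma U_mono c d : triple_le d c -> forall f, f \in U_ d -> f \in U_ c.
Proof.
move=> [le1 le2 le3] f /asboolP[fH fS]; apply/asboolP; split=> // h x hc.
apply: fH; case/and3P: hc => h1 h2 h3; apply/and3P.
have le_ideal m n (y : k) : (m <= n)%N -> y \in idealpow n -> y \in idealpow m.
  move=> mn; rewrite !unfold_in => /orP[->//|ny].
  by apply/orP; right; apply: le_trans ny; rewrite lez_nat.
by split; [exact: le_ideal le1 h1|exact: le_ideal le2 h2|exact: le_ideal le3 h3].
Qed.

Lemma borel_sub_C c g : g \in borel -> g \in C_ c.
Proof.
by case/and3P => /eqP h1 /eqP h2 /eqP h3; apply/and3P; rewrite h1 h2 h3 !idealpow0.
Qed.

Lemma borel_diag_unit (g : K) i : g \in borel -> val g i i \is a GRing.unit.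
Proof.
have entry0 a b : entry g a b == 0 -> val g a b = 0.
  by move=> /eqP e; apply: val_inj; exact: e.
case/and3P => /entry0 h1 /entry0 h2 /entry0 h3.
have trig : is_trig_mx (val g)^T.
  apply/is_trig_mxP => a b; rewrite mxE.
  case: a => [[|[|[|//]]] ai]; case: b => [[|[|[|//]]] bi] //= _.
  - by rewrite -h1; congr (val g _ _); apply: val_inj.
  - by rewrite -h3; congr (val g _ _); apply: val_inj.
  - by rewrite -h2; congr (val g _ _); apply: val_inj.
have := valP g; rewrite unitmxE -det_tr (det_trig trig) => gU.
have := gU; rewrite (bigD1 i) //= unitrM => /andP[+ _].
by rewrite mxE.
Qed.

Lemma U_sub_IndB c : is_cond chi2 M ->
  forall f, f \in U_ c -> f \in Ind borel chi_B.
Proof.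
move=> [chi2M _] f /asboolP[fH fS]; apply/asboolP; split=> // b x bB.
rewrite fH ?borel_sub_C //; congr (_ * _); rewrite /chi_c /chi_B.
case: eqP => // M0; rewrite chi2M // M0.
have /andP[b0 bv] : val b 1 1 \in @integers_unit k := borel_diag_unit 1 bB.
by apply/and3P; split=> //; exact: valP (val b 1 1 - 1).
Qed.

End Vc.

(* Main.v *)
Require Import Defs.
From HB Require Import structures.
From mathcomp Require Import all_boot all_order all_algebra.
From mathcomp Require Import ring_quotient finfield zify ring.
From mathcomp Require Import boolp functions reals complex.

Set Implicit Arguments.
Unset Strict Implicit.
Unset Printing Implicit Defensive.

Import Order.TTheory GRing.Theory Num.Theory VectorInternalTheory.
Local Open Scope ring_scope.

(** Write c = (m, n, max n m), and let W be the sum of the U_d with d < c; it is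
    already the sum over the two maximal such d, namely (m-1, n, c_3) and
    (m, n-1, c_3).  Let H be the subgroup of K of matrices whose diagonal is
    scalar mod p and with g_21 in p^(m-1), g_32 in p^(n-1), g_31 in p^(c_3); for
    m = 1 this is not a group and one takes instead g_31 in p^(n-1) and g_12 in p.
    For a nontrivial additive character w of the residue field,
      theta(g) = chi_2(g_22) chi_3(g_33) w(g_21 / (p^(m-1) g_11) + g_32 / (p^(n-1) g_22))
    (p denoting a uniformizer) is a character of H.  Averaging over H on the left
    against theta gives a K-equivariant map L from U_c to Ind_H^K theta:

    - L kills W because w is nontrivial, and conversely the kernel of L is W: torus
      translates of L f = 0 give the vanishing of all nondegenerate Fourier
      coefficients of f along the lower unipotent directions;
    - if g in K intertwines theta with itself then g is in H.  It is enough to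
      test the pairs 1 + y g E_ji and 1 + y E_ji g, which are conjugate under g.

    If now S is a subrepresentation with W < S <= U_c, translating and then
    averaging on the right over H some f in S with L f <> 0 gives f' in S such
    that L f' is a nonzero multiple of the function theta supported on H, whose
    translates span Ind_H^K theta.  Hence L(S) = L(U_c) and S = U_c. *)

(** * Quotient representations and a criterion for their irreducibility *)

Section QuotientMap.
Variables (G : groupType) (F : fieldType) (V : representation G F).
Local Open Scope quotient_scope.

Lemma quot_piE (W : subrep V) (u v : V) :
  (\pi_(quot_space W) u = \pi_(quot_space W) v) <-> (u - v \in W).
Proof.
by rewrite -[_ \in W]/(Quotient.equiv _ u v); split=> [/eqmodP|?] //; exact/eqmodP.
Qed.

Lemma quot_pi_lin (W : subrep V) a (u v : V) :
  \pi_(quot_space W) (a *: u + v) =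
  a *: (\pi_(quot_space W) u : quot_rep W) + (\pi_(quot_space W) v : quot_rep W).
Proof.
have -> : a *: (\pi_(quot_space W) u : quot_rep W) = \pi_(quot_space W) (a *: u).
  by apply/quot_piE; rewrite -scalerBr rpredZ //; apply/quot_piE; rewrite reprK.
by rewrite [LHS]Quotient.pi_add.
Qed.

Lemma quot_pi0 (W : subrep V) : \pi_(quot_space W) 0 = (0 : quot_rep W).
Proof.
apply: (addrI (\pi_(quot_space W) 0 : quot_rep W)).
by rewrite -[X in X + _]scale1r -quot_pi_lin scale1r !addr0.
Qed.

Lemma rep_act_lin (g : G) a (u v : V) :
  rep_act g (a *: u + v) = a *: rep_act g u + rep_act g v.
Proof. exact: rep_linear. Qed.

Lemma quot_pi_act (W : subrep V) g (v : V) :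
  rep_act g (\pi_(quot_space W) v : quot_rep W) = \pi_(quot_space W) (rep_act g v).
Proof.
apply/quot_piE; rewrite -scaleN1r addrC -rep_act_lin subrep_act // scaleN1r addrC.
by apply/quot_piE; rewrite reprK.
Qed.

End QuotientMap.

Section QuotientIrreducible.
Variables (G : groupType) (F : fieldType) (V : representation G F).
Local Open Scope quotient_scope.

(** Subrepresentations of the quotient correspond to those of [V] lying between the intersection of
    [U] and [S] and [U], so irreducibility becomes a statement inside [V]. *)
Lemma irreducible_quot (U S : subrep V) :
  (exists2 u, u \in U & u \notin S) ->
  (forall T : subrep V, {subset T <= U} ->
     (forall v, v \in U -> v \in S -> v \in T) ->
     (exists2 v, v \in T & v \notin S) -> {subset U <= T}) ->
  irreducible_rep (quot_rep (restrict_subrep U S)).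
Proof.
set W := restrict_subrep U S => -[u uU uS] key.
pose Q := quot_rep W.
have pi_eq0 (v : rep_of_subrep U) : \pi_(quot_space W) v = (0 : Q) -> val v \in S.
  move=> v0; have := (quot_piE W v 0).1; rewrite subr0; apply.
  by rewrite v0 quot_pi0.
split.
  exists (\pi_(quot_space W) (Sub u uU : rep_of_subrep U) : Q).
  by apply: contraNneq uS => /pi_eq0.
move=> X.
have [X0|/existsNP[v /not_implyP[vX v0]]] :=
  pselect (forall v, v \in X -> v = 0); first by left.
right.
(* The preimage of [X] in [V]; the membership proof is quantified inside because the projection is
   defined on [U] only. *)
pose inT (w : V) := exists wU : w \in U,
  (\pi_(quot_space W) (Sub w wU : rep_of_subrep U) : Q) \in X.
pose P : {pred V} := fun w => `[< inT w >].
have PE w : (w \in P) = `[< inT w >] by [].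
have Psub : submod_closed P.
  split=> [|a x y]; rewrite ?PE.
    apply/asboolP; exists (rpred0 U); rewrite (_ : \pi _ = (0 : Q)) ?rpred0 //.
    by rewrite -quot_pi0; apply/quot_piE; rewrite unfold_in /= subr0 rpred0.
  move=> /asboolP[xU xX] /asboolP[yU yX]; apply/asboolP.
  have xyU : a *: x + y \in U by rewrite rpredD // rpredZ.
  exists xyU.
  have -> : Sub (a *: x + y) xyU = a *: (Sub x xU : rep_of_subrep U) + Sub y yU.
    exact: val_inj.
  by rewrite quot_pi_lin rpredD // rpredZ.
have Pact g w : w \in P -> rep_act g w \in P.
  rewrite !PE => /asboolP[wU wX]; apply/asboolP; exists (subrep_act g wU).
  have -> : Sub (rep_act g w) (subrep_act g wU) =
     rep_act g (Sub w wU : rep_of_subrep U) by exact: val_inj.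
  by rewrite -quot_pi_act subrep_act.
pose T := Subrep Psub Pact.
have reprE (x : Q) : \pi_(quot_space W) (repr x : rep_of_subrep U) = x.
  exact: reprK.
have UT : {subset U <= T}.
  apply: key.
  - by move=> w; rewrite -[w \in T]/(w \in P) PE => /asboolP[].
  - move=> w wU wS; rewrite -[w \in T]/(w \in P) PE; apply/asboolP; exists wU.
    rewrite (_ : \pi _ = (0 : Q)) ?rpred0 // -quot_pi0.
    by apply/quot_piE; rewrite subr0.
  - pose r : rep_of_subrep U := repr v.
    exists (val r).
      rewrite -[_ \in T]/(_ \in P) PE; apply/asboolP; exists (valP r).
      have -> : Sub (val r) (valP r) = r by exact: val_inj.
      by rewrite reprE.
    apply/negP => rS; apply: v0; rewrite -(reprE v) -quot_pi0.
    by apply/quot_piE; rewrite subr0.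
move=> x; pose r : rep_of_subrep U := repr x.
have : val r \in T by apply: UT; exact: valP.
rewrite -[_ \in T]/(_ \in P) PE => /asboolP[rU].
have -> : Sub (val r) rU = r by exact: val_inj.
by rewrite reprE.
Qed.

End QuotientIrreducible.

(** * Averages over cosets *)

Section Averaging.
Variables (G : groupType) (F : fieldType).
Implicit Types (C D : {pred G}) (psi : G -> F).

Definition is_subgroup D : Prop :=
  (1%g \in D) /\ (forall x y, x \in D -> y \in D -> (x * y^-1)%g \in D).

Definition coset_transversal C D (I : finType) (r : I -> G) : Prop :=
  [/\ forall i, r i \in D,
      forall h, h \in D -> exists i, (h * (r i)^-1)%g \in C
    & forall i j, (r i * (r j)^-1)%g \in C -> i = j].

Definition multiplicative_on D psi : Prop :=
  (forall x, x \in D -> psi x != 0) /\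
  (forall x y, x \in D -> y \in D -> psi (x * y)%g = psi x * psi y).

Definition equivariant D psi (f : G -> F) : Prop :=
  forall h x, h \in D -> f (h * x)%g = psi h * f x.

Lemma is_subgroupMV D : 1%g \in D ->
  (forall x y, x \in D -> y \in D -> (x * y)%g \in D) ->
  (forall x, x \in D -> x^-1%g \in D) -> is_subgroup D.
Proof. by move=> D1 DM DV; split=> // x y xD yD; apply/DM/DV. Qed.

Lemma subgroupV D x : is_subgroup D -> x \in D -> x^-1%g \in D.
Proof. by case=> D1 DV xD; rewrite -[x^-1%g]mul1g DV. Qed.

Lemma subgroupM D x y : is_subgroup D -> x \in D -> y \in D -> (x * y)%g \in D.
Proof.
by move=> gD xD yD; rewrite -[y]invgK; apply: gD.2 => //; exact: subgroupV.
Qed.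

Lemma subgroupI C D :
  is_subgroup C -> is_subgroup D -> is_subgroup [predI C & D].
Proof.
move=> [C1 CV] [D1 DV]; split; first by rewrite inE C1.
by move=> x y /andP[xC xD] /andP[yC yD]; rewrite inE /= CV //= DV.
Qed.

(** Right multiplication by h permutes the cosets C (r i): one has r i h = c r (s i) with c in C.
    The factor psi c that comes out of f is psi (r i) psi h / psi (r (s i)), so each term is psi h
    times the term of index s i. *)
Lemma average_equivariant C D psi (I : finType) (r : I -> G) (f : G -> F) :
  is_subgroup C -> is_subgroup D -> {subset C <= D} -> multiplicative_on D psi ->
  coset_transversal C D r -> equivariant C psi f ->
  equivariant D psi (fun x => \sum_i (psi (r i))^-1 * f (r i * x)%g).
Proof.
move=> gC gD sCD [psi0 psiM] [rD rex rinj] fC h x hD.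
have /choice[s sP] i : exists j, (r i * h * (r j)^-1)%g \in C.
  exact/rex/subgroupM.
have s_inj : injective s.
  move=> i j eij; apply: rinj.
  have := gC.2 _ _ (sP i) (sP j).
  by rewrite eij !invgM !invgK !mulgA mulgVK mulgK.
rewrite [in RHS](reindex_inj s_inj) mulr_sumr; apply: eq_bigr => i _.
set c := (r i * h * (r (s i))^-1)%g in sP *.
have cD : c \in D by apply: sCD; exact: sP.
have rE : (r i * h = c * r (s i))%g by rewrite /c mulgVK.
have := psiM _ _ (rD i) hD; rewrite rE psiM // => pE.
rewrite mulgA rE -mulgA (fC _ _ (sP i)).
have p0 := psi0 _ (rD i); have p1 := psi0 _ (rD (s i)).
rewrite [LHS]mulrA [RHS]mulrA; congr (_ * _).
by apply: (mulfI p0); rewrite mulVKf // mulrA -pE mulfK.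
Qed.

(** The map [rho] to a finite type separates the cosets, which bounds their number. Each coset
    receives a canonical element; the values of [rho] are enumerated and duplicates removed. *)
Lemma coset_transversal_exists C D (T : finType) (rho : G -> T) :
  is_subgroup C -> is_subgroup D ->
  (forall x y, x \in D -> y \in D -> rho x = rho y -> (x * y^-1)%g \in C) ->
  exists n (r : 'I_n -> G), coset_transversal C D r.
Proof.
move=> gC gD rhoP.
pose R x : pred G := fun y => `[< y \in D /\ (x * y^-1)%g \in C >].
(* [choose] depends only on the extension of the predicate once its default satisfies it, so [can]
   is constant on cosets. *)
pose can x := choose (R x) x.
have Rxx x : x \in D -> R x x.
  by move=> xD; apply/asboolP; rewrite mulgV; split=> //; exact: gC.1.
have canP x : x \in D -> can x \in D /\ (x * (can x)^-1)%g \in C.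
  by move=> xD; apply/asboolP; exact: chooseP (Rxx _ xD).
have can_eq x y : x \in D -> y \in D -> (x * y^-1)%g \in C -> can x = can y.
  move=> xD yD xyC; rewrite /can.
  have RE : R x =1 R y.
    move=> z; apply/asboolP/asboolP => -[zD zC]; split=> //.
      have := subgroupM gC (subgroupV gC xyC) zC.
      by rewrite invgM invgK !mulgA mulgVK.
    by have := subgroupM gC xyC zC; rewrite !mulgA mulgVK.
  rewrite -(eq_choose RE); apply: choose_id; first exact: Rxx.
  by apply/asboolP.
pose g (t : T) : option G :=
  if pselect (exists2 x, x \in D & rho x = t) is left e
  then Some (can (s2val (cid2 e))) else None.
pose s := undup (pmap g (enum T)).
have gP t x : g t = Some x -> exists2 y, y \in D & x = can y.
  rewrite /g; case: pselect => // e [<-]; exists (s2val (cid2 e)) => //.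
  exact: (s2valP (cid2 e)).
have sP x : x \in s -> exists2 y, y \in D & x = can y.
  rewrite mem_undup mem_pmap => /mapP[t _ e]; exact: (gP t).
have memr (i : 'I_(size s)) : nth 1%g s i \in s by exact: mem_nth.
exists (size s), (fun i => nth 1%g s i); split.
- by move=> i; have [y yD ->] := sP _ (memr i); exact: (canP y yD).1.
- move=> h hD.
  have cs : can h \in s.
    rewrite mem_undup mem_pmap; apply/mapP; exists (rho h).
      by rewrite mem_enum.
    rewrite /g; case: pselect => [e|]; last by case; exists h.
    congr Some; have hh := s2valP' (cid2 e); have hd := s2valP (cid2 e).
    by apply: can_eq => //; apply: rhoP => //; rewrite hh.
  have ix : (index (can h) s < size s)%N by rewrite index_mem.
  by exists (Ordinal ix); rewrite nth_index //; exact: (canP h hD).2.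
- move=> i j.
  have [y yD ey] := sP _ (memr i); have [z zD ez] := sP _ (memr j).
  move=> ijC; apply/val_inj/eqP.
  rewrite -(@nth_uniq _ 1%g s _ _ (ltn_ord i) (ltn_ord j)) ?undup_uniq //.
  have idem t : t \in D -> can (can t) = can t.
    move=> tD; have [cD cC] := canP t tD; apply: can_eq => //.
    by have := subgroupV gC cC; rewrite invgM invgK.
  apply/eqP; rewrite -/s ey ez -(idem y) // -(idem z) //.
  apply: can_eq; rewrite -?ey -?ez //.
    by rewrite ey; exact: (canP y yD).1.
  by rewrite ez; exact: (canP z zD).1.
Qed.

End Averaging.

(** * Ideals of the integer ring *)

Section IntegerIdeals.
Variable k : padicField.
Notation R := (integers k).
Implicit Types (x y u : R) (i j : nat).

Definition inP j : {pred R} := fun x => val x \in @idealpow k j.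

Fact uniformizer_exists : exists x : R, val x != 0 /\ dv (val x) = 1.
Proof.
have [w w0 dw] := dv_uniformizer k.
have wR : w \in @idealpow k 0 by rewrite unfold_in /= dw orbT.
by exists (Sub w wR).
Qed.

Definition unif : R := sval (cid uniformizer_exists).

Lemma val_unif0 : val unif != 0.
Proof. by have [] := svalP (cid uniformizer_exists). Qed.

Lemma dv_unif : dv (val unif) = 1.
Proof. by have [] := svalP (cid uniformizer_exists). Qed.

Lemma val_unifX j : val (unif ^+ j) = val unif ^+ j.
Proof. by elim: j => // j IHj; rewrite !exprS -IHj. Qed.

Lemma val_unifX0 j : val (unif ^+ j) != 0.
Proof. by rewrite val_unifX expf_neq0 ?val_unif0. Qed.

Lemma dv_unifX j : dv (val (unif ^+ j)) = j%:Z.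
Proof.
elim: j => [|j IHj]; first by rewrite expr0 dv1.
rewrite exprS dvM ?val_unif0 ?val_unifX0 // IHj dv_unif.
by rewrite -[1]/(1%:Z) -PoszD add1n.
Qed.

Lemma inPP j x : reflect (exists y, x = unif ^+ j * y) (x \in inP j).
Proof.
apply: (iffP idP) => [|[y ->]].
  rewrite !unfold_in; have [x0|x0 /= xj] := eqVneq (val x) 0.
    by move=> _; exists 0; rewrite mulr0; apply: val_inj; rewrite x0.
  have yR : val x / val (unif ^+ j) \in @idealpow k 0.
    rewrite unfold_in /= dvM ?invr_eq0 ?val_unifX0 // dvV ?val_unifX0 //.
    by rewrite dv_unifX subr_ge0 xj orbT.
  exists (Sub (val x / val (unif ^+ j)) yR); apply: val_inj.
  by rewrite /= mulrC divfK ?val_unifX0.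
have := valP y; rewrite !unfold_in /= mulf_eq0.
have [//|y0] := eqVneq (val y) 0; rewrite ?orbT //= => yR.
rewrite dvM ?val_unifX0 // dv_unifX (negPf (val_unifX0 _)) /=.
by rewrite lerDl.
Qed.

Lemma unifX_inj j : injective ( *%R (unif ^+ j)).
Proof.
move=> x y e; apply: val_inj; apply: (mulfI (val_unifX0 j)).
exact: (congr1 val e).
Qed.

Lemma inP_0 x : x \in inP 0.
Proof. by apply/inPP; exists x; rewrite mul1r. Qed.

Lemma inP0 j : 0 \in inP j.
Proof. by apply/inPP; exists 0; rewrite mulr0. Qed.

Lemma inPD j x y : x \in inP j -> y \in inP j -> x + y \in inP j.
Proof.
by move=> /inPP[a ->] /inPP[b ->]; apply/inPP; exists (a + b); rewrite mulrDr.
Qed.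

Lemma inPN j x : (- x \in inP j) = (x \in inP j).
Proof.
apply/inPP/inPP => -[y xE]; exists (- y); rewrite mulrN -xE ?opprK //.
Qed.

Lemma inPB j x y : x \in inP j -> y \in inP j -> x - y \in inP j.
Proof. by move=> xj yj; rewrite inPD // inPN. Qed.

Lemma inPM i j l x y :
  x \in inP i -> y \in inP j -> (l <= i + j)%N -> x * y \in inP l.
Proof.
move=> /inPP[a ->] /inPP[b ->] lij; apply/inPP.
exists (unif ^+ (i + j - l) * (a * b)).
by rewrite [RHS]mulrA -exprD subnKC // mulrACA -exprD.
Qed.

Lemma inPW i j x : (i <= j)%N -> x \in inP j -> x \in inP i.
Proof.
by move=> ij xj; rewrite -[x]mulr1; apply: (inPM xj (inP_0 1)); rewrite addn0.
Qed.

Lemma inPMl j x y : y \in inP j -> x * y \in inP j.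
Proof. by move=> yj; apply: (inPM (inP_0 x) yj). Qed.

Lemma inPMr j x y : x \in inP j -> x * y \in inP j.
Proof. by move=> xj; rewrite mulrC inPMl. Qed.

Lemma inPX i j x : (i <= j)%N -> unif ^+ j * x \in inP i.
Proof. by move=> ij; apply: (inPW ij); apply/inPP; exists x. Qed.

Lemma inPXD i j x : (unif ^+ j * x \in inP (j + i)) = (x \in inP i).
Proof.
apply/inPP/inPP => -[y xE].
  by exists y; apply: (@unifX_inj j); rewrite xE exprD mulrA.
by exists y; rewrite xE exprD mulrA.
Qed.

Notation res := (residue k).

Lemma res_eq0 x : (res x == 0) = (x \in inP 1).
Proof. by apply/eqP/idP => /residue_ker. Qed.

Lemma res_eq x y : (res x == res y) = (x - y \in inP 1).
Proof. by rewrite -res_eq0 rmorphB subr_eq0. Qed.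

Lemma unit_res x : (x \is a GRing.unit) = (res x != 0).
Proof.
apply/idP/idP => [xU|].
  apply/eqP => x0; have := rmorph1 res; rewrite -(mulrV xU) rmorphM x0 mul0r.
  by move=> /eqP; rewrite eq_sym oner_eq0.
rewrite res_eq0 => xP; rewrite -[_ \is a _]/((val x != 0) && (dv (val x) == 0)).
have := valP x; move: xP; rewrite !unfold_in /= negb_or => /andP[x0 x1].
by rewrite x0 (negPf x0) /=; lia.
Qed.

Lemma unitD x y : y \in inP 1 -> (x + y \is a GRing.unit) = (x \is a GRing.unit).
Proof. by rewrite -res_eq0 => /eqP y0; rewrite !unit_res rmorphD y0 addr0. Qed.

Lemma unit1D y : y \in inP 1 -> 1 + y \is a GRing.unit.
Proof. by move=> yP; rewrite unitD // unitr1. Qed.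

Lemma inP1_or_unit x : x \in inP 1 \/ x \is a GRing.unit.
Proof. by rewrite unit_res res_eq0; case: (x \in inP 1); [left|right]. Qed.

Lemma notin_inP j x : x \notin inP j ->
  exists i u, [/\ (i < j)%N, u \is a GRing.unit & x = unif ^+ i * u].
Proof.
elim: j x => [|j IHj] x; first by rewrite inP_0.
have [/inPP[y ->]|xU _] := inP1_or_unit x; last first.
  by exists 0%N, x; rewrite mul1r.
rewrite -[j.+1]add1n inPXD => /IHj[i [u [ij uU ->]]].
by exists i.+1, u; rewrite mulrA -exprD.
Qed.

(** The quotient of x by the j-th power of the uniformizer, with default value 0 outside p^j. *)
Definition divpi j x : R :=
  if pselect (exists y, x = unif ^+ j * y) is left e then sval (cid e) else 0.

Lemma divpiK j x : x \in inP j -> unif ^+ j * divpi j x = x.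
Proof.
move=> /inPP e; rewrite /divpi; case: pselect => // e'.
by rewrite -(svalP (cid e')).
Qed.

Lemma divpiXK j x : divpi j (unif ^+ j * x) = x.
Proof. by apply: (@unifX_inj j); rewrite divpiK ?inPX. Qed.

(* The residue of [x / unif ^+ j], meaningful for [x] in p^j only. *)
Definition coef j x : residue_field k := res (divpi j x).

Lemma coefX j x : coef j (unif ^+ j * x) = res x.
Proof. by rewrite /coef divpiXK. Qed.

Lemma coefD j x y : x \in inP j -> y \in inP j -> coef j (x + y) = coef j x + coef j y.
Proof. by move=> /inPP[a ->] /inPP[b ->]; rewrite -mulrDr !coefX rmorphD. Qed.

Lemma coefMl j x y : y \in inP j -> coef j (x * y) = res x * coef j y.
Proof. by move=> /inPP[b ->]; rewrite mulrCA !coefX rmorphM. Qed.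

Lemma coefMr j x y : x \in inP j -> coef j (x * y) = coef j x * res y.
Proof. by move=> xP; rewrite mulrC coefMl // mulrC. Qed.

Lemma coef_eq0 j x : x \in inP j -> (coef j x == 0) = (x \in inP j.+1).
Proof. by move=> /inPP[b ->]; rewrite coefX -addn1 inPXD res_eq0. Qed.

Lemma coef_small j x : x \in inP j.+1 -> coef j x = 0.
Proof. by move=> xP; apply/eqP; rewrite coef_eq0 // (inPW _ xP). Qed.

Definition reslift (a : residue_field k) : R := sval (cid (residue_surj a)).

Lemma reslift_id a : res (reslift a) = a.
Proof. exact: svalP (cid (residue_surj a)). Qed.

(** The i-th digit of the expansion of x in powers of the uniformizer, digits being lifted by
    [reslift]. *)
Definition digit i x := res (iter i (fun z => divpi 1 (z - reslift (res z))) x).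

(** The first j digits take finitely many values and determine x modulo p^j; this gives the finite
    index of the congruence subgroups. *)
Lemma digit_inj j x y :
  (forall i, (i < j)%N -> digit i x = digit i y) -> x - y \in inP j.
Proof.
elim: j x y => [|j IHj] x y e; first exact: inP_0.
have e0 : res x = res y by apply: (e 0%N).
have zE z : unif * divpi 1 (z - reslift (res z)) + reslift (res z) = z.
  by rewrite -[unif]expr1 divpiK ?subrK // -res_eq0 rmorphB reslift_id subrr.
rewrite -(zE x) -(zE y) e0 opprD addrACA subrr addr0 -mulrBr -[unif]expr1.
rewrite -[j.+1]add1n inPXD; apply: IHj => i ij.
by have := e i.+1 ij; rewrite /digit !iterSr e0.
Qed.

End IntegerIdeals.

Ltac nat_lia :=
  repeat match goal with H : is_true (_ \in _) |- _ => clear H end; lia.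

(** Membership in p^j by structure: sums term by term, products through one factor or by adding the
    exponents of both, inequalities by [lia]. *)
Ltac inP_tac :=
  match goal with
  | |- is_true (_ \in inP 0) => exact: inP_0
  | |- is_true (0 \in inP _) => exact: inP0
  | H : is_true (?x \in inP _) |- is_true (?x \in inP _) =>
      first [exact: H | apply: inPW H; nat_lia]
  | |- is_true (unif _ ^+ _ * _ \in inP _) => apply: inPX; nat_lia
  | |- is_true (_ + _ \in inP _) => apply: inPD; inP_tac
  | |- is_true (- _ \in inP _) => rewrite inPN; inP_tac
  | |- is_true (?x * ?y \in inP _) =>
      first
        [ apply: inPMl; inP_tac
        | apply: inPMr; inP_tac
        | match goal with
          | H : is_true (x \in inP _), H' : is_true (y \in inP _) |- _ =>
              apply: (inPM H H'); nat_lia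
          end ]
  end.

(** * Matrices of size 3 *)

Section ThreeByThree.
Variable R : comNzRingType.

Lemma ord3P (i : 'I_3) : [\/ i = 0, i = 1 | i = 2].
Proof.
case: i => [[|[|[|//]]] ltp]; [constructor 1|constructor 2|constructor 3];
  exact: val_inj.
Qed.

Lemma sum3E (f : 'I_3 -> R) : \sum_i f i = f 0 + f 1 + f 2.
Proof.
rewrite !big_ord_recl big_ord0 addr0 addrA.
by congr (f _ + f _ + f _); apply: val_inj.
Qed.

Definition mx3 (a b c d e f g h i : R) : 'M[R]_3 :=
  \matrix_(x, y) nth 0 (nth [::] [:: [:: a; b; c]; [:: d; e; f]; [:: g; h; i]] x) y.

Lemma mx3E a b c d e f g h i (A := mx3 a b c d e f g h i) :
  ((A 0 0 = a) * (A 0 1 = b) * (A 0 2 = c) *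
   (A 1 0 = d) * (A 1 1 = e) * (A 1 2 = f) *
   (A 2 0 = g) * (A 2 1 = h) * (A 2 2 = i))%type.
Proof. by do !split; rewrite mxE. Qed.

Lemma mx3_ext (A B : 'M[R]_3) :
  A 0 0 = B 0 0 -> A 0 1 = B 0 1 -> A 0 2 = B 0 2 ->
  A 1 0 = B 1 0 -> A 1 1 = B 1 1 -> A 1 2 = B 1 2 ->
  A 2 0 = B 2 0 -> A 2 1 = B 2 1 -> A 2 2 = B 2 2 -> A = B.
Proof.
move=> *; apply/matrixP => i j.
by have [] := ord3P i => ->; have [] := ord3P j => ->.
Qed.

Definition adj3 (A : 'M[R]_3) : 'M[R]_3 :=
  mx3 (A 1 1 * A 2 2 - A 1 2 * A 2 1) (A 0 2 * A 2 1 - A 0 1 * A 2 2)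
      (A 0 1 * A 1 2 - A 0 2 * A 1 1)
      (A 1 2 * A 2 0 - A 1 0 * A 2 2) (A 0 0 * A 2 2 - A 0 2 * A 2 0)
      (A 0 2 * A 1 0 - A 0 0 * A 1 2)
      (A 1 0 * A 2 1 - A 1 1 * A 2 0) (A 0 1 * A 2 0 - A 0 0 * A 2 1)
      (A 0 0 * A 1 1 - A 0 1 * A 1 0).

Definition det3 (A : 'M[R]_3) :=
  A 0 0 * (A 1 1 * A 2 2 - A 1 2 * A 2 1) -
  A 0 1 * (A 1 0 * A 2 2 - A 1 2 * A 2 0) +
  A 0 2 * (A 1 0 * A 2 1 - A 1 1 * A 2 0).

Lemma mulmx3E (A B : 'M[R]_3) i j :
  (A *m B) i j = A i 0 * B 0 j + A i 1 * B 1 j + A i 2 * B 2 j.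
Proof. by rewrite mxE sum3E. Qed.

Lemma scalar3E (a : R) (i j : 'I_3) : a%:M i j = if i == j then a else 0.
Proof. by rewrite mxE; case: eqP. Qed.

Lemma mul_mx_adj3 A : A *m adj3 A = (det3 A)%:M.
Proof. by apply: mx3_ext; rewrite mulmx3E scalar3E /= !mx3E /det3; ring. Qed.

Lemma det3M A B : det3 (A *m B) = det3 A * det3 B.
Proof. by rewrite /det3 !mulmx3E; ring. Qed.

End ThreeByThree.

(** * The group GL(3, R) through matrix entries *)

Section GL3.
Variable k : padicField.
Notation R := (integers k).
Notation K := (GL3 k).

Lemma unitmx3 (A : 'M[R]_3) : det3 A \is a GRing.unit -> A \in unitmx.
Proof.
move=> dU.
have : A *m ((det3 A)^-1 *: adj3 A) = 1%:M.
  by rewrite -scalemxAr mul_mx_adj3 scale_scalar_mx mulVr.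
by move=> /mulmx1_unit[].
Qed.

Lemma det3_unit (A : 'M[R]_3) : A \in unitmx -> det3 A \is a GRing.unit.
Proof.
move=> AU; have : det3 A * det3 (invmx A) = 1.
  by rewrite -det3M mulmxV // /det3 !scalar3E /=; ring.
by move=> e; apply/unitrP; exists (det3 (invmx A)); rewrite mulrC e.
Qed.

Definition ent (g : K) (i j : 'I_3) : R := val g i j.

Lemma entM (g h : K) i j : ent (g * h)%g i j =
  ent g i 0 * ent h 0 j + ent g i 1 * ent h 1 j + ent g i 2 * ent h 2 j.
Proof. exact: mulmx3E. Qed.

Lemma ent1 i j : ent 1%g i j = if i == j then 1 else 0.
Proof. exact: scalar3E. Qed.

Lemma ent_ext (g h : K) : (forall i j, ent g i j = ent h i j) -> g = h.
Proof. by move=> e; apply: val_inj; apply/matrixP. Qed.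

Lemma ent_ext9 (g h : K) :
  ent g 0 0 = ent h 0 0 -> ent g 0 1 = ent h 0 1 -> ent g 0 2 = ent h 0 2 ->
  ent g 1 0 = ent h 1 0 -> ent g 1 1 = ent h 1 1 -> ent g 1 2 = ent h 1 2 ->
  ent g 2 0 = ent h 2 0 -> ent g 2 1 = ent h 2 1 -> ent g 2 2 = ent h 2 2 ->
  g = h.
Proof. by move=> *; apply: val_inj; apply: mx3_ext. Qed.

(** A matrix whose determinant is not a unit is sent to the identity, hence the condition in
    [ent_GL3_of]. The lock prevents unfolding by conversion. *)
Definition GL3_of (a b c d e f g h i : R) : K :=
  locked insubd (1%g : K) (mx3 a b c d e f g h i).

Lemma ent_GL3_of a b c d e f g h i (A := GL3_of a b c d e f g h i) :
  a * (e * i - f * h) - b * (d * i - f * g) + c * (d * h - e * g) \is a GRing.unit ->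
  ((ent A 0 0 = a) * (ent A 0 1 = b) * (ent A 0 2 = c) *
   (ent A 1 0 = d) * (ent A 1 1 = e) * (ent A 1 2 = f) *
   (ent A 2 0 = g) * (ent A 2 1 = h) * (ent A 2 2 = i))%type.
Proof.
move=> dU.
have AE i' j' : ent A i' j' = mx3 a b c d e f g h i i' j'.
  by rewrite /ent /A /GL3_of -lock val_insubd unitmx3 // /det3 !mx3E.
by rewrite !AE; do !split; rewrite mx3E.
Qed.

Definition GL3_det (g : K) : R :=
  ent g 0 0 * (ent g 1 1 * ent g 2 2 - ent g 1 2 * ent g 2 1) -
  ent g 0 1 * (ent g 1 0 * ent g 2 2 - ent g 1 2 * ent g 2 0) +
  ent g 0 2 * (ent g 1 0 * ent g 2 1 - ent g 1 1 * ent g 2 0).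

Lemma det_unit (g : K) : GL3_det g \is a GRing.unit.
Proof. exact: det3_unit (valP g). Qed.

Lemma entV (g : K) (A := ent g^-1%g) (d := (GL3_det g)^-1) :
  ((A 0 0 = (d * (ent g 1 1 * ent g 2 2 - ent g 1 2 * ent g 2 1))%R) *
   (A 0 1 = (d * (ent g 0 2 * ent g 2 1 - ent g 0 1 * ent g 2 2))%R) *
   (A 0 2 = (d * (ent g 0 1 * ent g 1 2 - ent g 0 2 * ent g 1 1))%R) *
   (A 1 0 = (d * (ent g 1 2 * ent g 2 0 - ent g 1 0 * ent g 2 2))%R) *
   (A 1 1 = (d * (ent g 0 0 * ent g 2 2 - ent g 0 2 * ent g 2 0))%R) *
   (A 1 2 = (d * (ent g 0 2 * ent g 1 0 - ent g 0 0 * ent g 1 2))%R) *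
   (A 2 0 = (d * (ent g 1 0 * ent g 2 1 - ent g 1 1 * ent g 2 0))%R) *
   (A 2 1 = (d * (ent g 0 1 * ent g 2 0 - ent g 0 0 * ent g 2 1))%R) *
   (A 2 2 = (d * (ent g 0 0 * ent g 1 1 - ent g 0 1 * ent g 1 0))%R))%type.
Proof.
have gU : det3 (val g) \is a GRing.unit := det3_unit (valP g).
have AE i j : A i j = d * adj3 (val g) i j.
  suff e : val (g^-1)%g = (det3 (val g))^-1 *: adj3 (val g).
    by rewrite /A /ent e mxE.
  apply: (can_inj (mulKmx (valP g))).
  rewrite -[LHS]/(val (g * g^-1)%g) mulgV -scalemxAr mul_mx_adj3.
  by rewrite scale_scalar_mx mulVr.
by rewrite !AE; do !split; rewrite mx3E.
Qed.

End GL3.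

(** * Subgroups cut out by the valuations of entries *)

Section Boxes.
Variable k : padicField.
Notation K := (GL3 k).
Implicit Types (g h : K) (a b c d : nat).

(** The groups C_c are the case d = 0; d = 1 serves the case m = 0, where H also constrains the
    entry (0,1). *)
Definition box a b c d : {pred K} := fun g =>
  [&& ent g 1 0 \in inP a, ent g 2 1 \in inP b, ent g 2 0 \in inP c
    & ent g 0 1 \in inP d].

Lemma boxP a b c d g : reflect
  [/\ ent g 1 0 \in inP a, ent g 2 1 \in inP b, ent g 2 0 \in inP c
    & ent g 0 1 \in inP d] (g \in box a b c d).
Proof. exact: and4P. Qed.

(** Each inequality controls one cross term of a product g h: g_21 h_10 in the entry (2,0), g_20
    h_01 in (2,1), g_12 h_20 in (1,0) and g_02 h_21 in (0,1). *)
Lemma box_subgroup a b c d : (c <= a + b)%N -> (b <= c + d)%N -> (a <= c)%N ->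
  (d <= b)%N -> is_subgroup (box a b c d).
Proof.
move=> cab bcd ac db; apply: is_subgroupMV.
- by apply/boxP; rewrite !ent1 /=; split; inP_tac.
- move=> g h /boxP[g1 g2 g3 g4] /boxP[h1 h2 h3 h4].
  by apply/boxP; rewrite !entM; split; inP_tac.
- move=> g /boxP[g1 g2 g3 g4].
  by apply/boxP; rewrite !entV; split; inP_tac.
Qed.

Lemma C_box (c : triple) : C_ c =i box (tr1 c) (tr2 c) (tr3 c) 0.
Proof.
move=> g; apply/idP/boxP => [/and3P[h1 h2 h3]|[h1 h2 h3 _]].
  by split=> //; exact: inP_0.
by apply/and3P; split.
Qed.

(** Modulo p the determinant is the product of the diagonal: every other term contains g_21, g_20 or
    the product g_10 g_01. *)
Lemma box_unit a b c d g : (0 < a + d)%N -> (0 < b)%N -> (0 < c)%N ->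
  g \in box a b c d ->
  [/\ ent g 0 0 \is a GRing.unit, ent g 1 1 \is a GRing.unit
    & ent g 2 2 \is a GRing.unit].
Proof.
move=> ad b0 c0 /boxP[g1 g2 g3 g4].
suff : ent g 0 0 * (ent g 1 1 * ent g 2 2) \is a GRing.unit.
  by rewrite !unitrM => /and3P[].
have := det_unit g; rewrite /GL3_det.
set x := (X in X \is a _ -> _); set y := _ * _.
suff xy : x - y \in inP 1 by rewrite -(subrK y x) addrC unitD.
have -> : x - y = - (ent g 0 0 * ent g 1 2 * ent g 2 1) -
   (ent g 1 0 * ent g 0 1) * ent g 2 2 + ent g 0 1 * ent g 1 2 * ent g 2 0 +
   ent g 0 2 * (ent g 1 0 * ent g 2 1 - ent g 1 1 * ent g 2 0).
  by rewrite /x /y; ring.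
by inP_tac.
Qed.

Lemma equivariant_box_le (F : fieldType) (psi f : K -> F) a b c d a' b' c' d' :
  [/\ a <= a', b <= b', c <= c' & d <= d']%N ->
  equivariant (box a b c d) psi f -> equivariant (box a' b' c' d') psi f.
Proof.
move=> [aa bb cc dd] fE h x /boxP[h1 h2 h3 h4]; apply: fE.
by apply/boxP; split; inP_tac.
Qed.

End Boxes.

(** * Values of a character on units, modulo its conductor *)

Section CharacterValues.
Variables (k : padicField) (F : fieldType) (chi : k -> F) (c : nat).
Hypotheses (chi_char : is_character chi)
  (chi_cond : forall x, x \in unit_filtration c -> chi x = 1).
Implicit Types x y z : integers k.

Lemma unit_val_neq0 x : x \is a GRing.unit -> val x != 0.
Proof.
by rewrite -[_ \is a _]/((val x != 0) && (dv (val x) == 0)) => /andP[].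
Qed.

Lemma char_unit_neq0 x : x \is a GRing.unit -> chi (val x) != 0.
Proof. by move=> /unit_val_neq0; case: chi_char => + _ _; apply. Qed.

(** The quotient z / (x y) lies in 1 + p^c, where [chi] is trivial. *)
Lemma char_mul_approx x y z : (0 < c)%N -> x \is a GRing.unit ->
  y \is a GRing.unit -> z - x * y \in inP c -> chi (val z) = chi (val x) * chi (val y).
Proof.
move=> c0 xU yU zP.
have [chi0 chiM _] := chi_char.
have xyU : x * y \is a GRing.unit by rewrite unitrM xU.
pose t := 1 + (x * y)^-1 * (z - x * y).
have zE : z = x * y * t by rewrite /t mulrDr mulr1 mulVKr // addrCA subrr addr0.
have tU : t \is a GRing.unit.
  by rewrite unit1D // inPMl // (inPW c0).
rewrite zE !rmorphM !chiM ?mulf_neq0 ?unit_val_neq0 //.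
rewrite [chi (val t)]chi_cond ?mulr1 //.
have := tU; rewrite -[_ \is a _]/((val t != 0) && (dv (val t) == 0)) => /andP[t0 t1].
rewrite unfold_in t0 t1 /= -[_ - 1]/(val (t - 1)).
rewrite -[_ \in _]/(t - 1 \in inP c) /t addrAC subrr add0r.
exact: inPMl.
Qed.

Lemma char_1D x : (0 < c)%N -> x \in inP c -> chi (val (1 + x)) = 1.
Proof.
move=> c0 xP.
have xU : 1 + x \is a GRing.unit by rewrite unit1D // (inPW c0).
apply: chi_cond; have := xU.
rewrite -[_ \is a _]/((val (1 + x) != 0) && (dv (val (1 + x)) == 0)).
move=> /andP[t0 t1]; rewrite unfold_in t0 t1 /= -[_ - 1]/(val (1 + x - 1)).
by rewrite -[_ \in _]/(1 + x - 1 \in inP c) addrAC subrr add0r.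
Qed.

End CharacterValues.

(** * The character chi_c on boxes *)

Section Setup.
Variables (k : padicField) (F : numFieldType) (chi2 chi3 : k -> F) (M N : nat).
Hypotheses (chi2_char : is_character chi2) (chi3_char : is_character chi3).
Hypotheses (chi2M : forall x, x \in unit_filtration M -> chi2 x = 1).
Hypotheses (chi3N : forall x, x \in unit_filtration N -> chi3 x = 1).
Hypotheses (leMN : (M <= N)%N) (N_gt0 : (0 < N)%N).
Notation R := (integers k).
Notation K := (GL3 k).
Notation kF := (residue_field k).
Notation res := (residue k).
Notation psi := (chi_c chi2 chi3 M).

(** The convention for M = 0 is kept inside [eta2]; the lemmas below ask for units only when M > 0,
    since the entry (1,1) may fail to be a unit when M = 0. *)
Definition eta2 (x : R) : F := if M == 0%N then 1 else chi2 (val x).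

Definition eta3 (x : R) : F := chi3 (val x).

Lemma psiE (g : K) : psi g = eta2 (ent g 1 1) * eta3 (ent g 2 2).
Proof. by []. Qed.

Lemma eta2M (x y z : R) :
  ((0 < M)%N -> [/\ x \is a GRing.unit, y \is a GRing.unit & z - x * y \in inP M]) ->
  eta2 z = eta2 x * eta2 y.
Proof.
rewrite /eta2; case: (M =P 0%N) => [_ _|/eqP]; first by rewrite mulr1.
rewrite -lt0n => M0 /(_ M0) [xU yU zP].
exact: (char_mul_approx chi2_char chi2M).
Qed.

Lemma eta2_neq0 (x : R) : ((0 < M)%N -> x \is a GRing.unit) -> eta2 x != 0.
Proof.
rewrite /eta2; case: (M =P 0%N) => [_ _|/eqP]; first by rewrite oner_eq0.
by rewrite -lt0n => M0 /(_ M0); exact: char_unit_neq0.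
Qed.

Lemma eta2_1D (x : R) : x \in inP M -> eta2 (1 + x) = 1.
Proof.
rewrite /eta2; case: (M =P 0%N) => [//|/eqP]; rewrite -lt0n => M0 xP.
exact: char_1D xP.
Qed.

Lemma eta2_1 : eta2 1 = 1.
Proof. by rewrite -[X in eta2 X](addr0 1) eta2_1D // inP0. Qed.

Lemma eta3_1D (x : R) : x \in inP N -> eta3 (1 + x) = 1.
Proof. exact: char_1D. Qed.

Lemma eta3_1 : eta3 1 = 1.
Proof. by rewrite -[X in eta3 X](addr0 1) eta3_1D // inP0. Qed.

Lemma eta3_neq0 (x : R) : x \is a GRing.unit -> eta3 x != 0.
Proof. exact: char_unit_neq0. Qed.

Lemma psiM (g h : K) :
  (ent g 2 2) \is a GRing.unit -> (ent h 2 2) \is a GRing.unit ->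
  ((0 < M)%N -> (ent g 1 1) \is a GRing.unit /\ (ent h 1 1) \is a GRing.unit) ->
  (ent g 1 0) * (ent h 0 1) \in inP M -> (ent g 1 2) * (ent h 2 1) \in inP M ->
  (ent g 2 0) * (ent h 0 2) \in inP N -> (ent g 2 1) * (ent h 1 2) \in inP N ->
  psi (g * h)%g = psi g * psi h.
Proof.
move=> g2 h2 g1 a1 a2 b1 b2; rewrite !psiE mulrACA; congr (_ * _).
  apply: eta2M => /g1[-> ->]; split=> //.
  by rewrite entM addrAC addrK inPD.
rewrite /eta3; apply: (char_mul_approx chi3_char chi3N) => //.
by rewrite entM addrK inPD.
Qed.

(** The off-diagonal contributions to the entries (1,1) and (2,2) of a product lie in p^M and p^N
    respectively. *)
Lemma psi_box_mult a b c d : (N <= b)%N -> (N <= c)%N -> (M <= a + d)%N ->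
  multiplicative_on (@box k a b c d) psi.
Proof.
move=> Nb Nc Mad.
have u2 g : g \in box a b c d -> ent g 2 2 \is a GRing.unit.
  move=> /boxP[g1 g2 g3 g4].
  have := det_unit g; rewrite /GL3_det.
  set x := (X in X \is a _ -> _).
  (* Expansion along the last row, whose other two entries lie in p; it remains available when a + d
     = 0, where [box_unit] does not apply. *)
  have -> : x = ent g 2 2 * (ent g 0 0 * ent g 1 1 - ent g 0 1 * ent g 1 0) +
     (ent g 2 1 * (ent g 0 2 * ent g 1 0 - ent g 0 0 * ent g 1 2) +
      ent g 2 0 * (ent g 0 1 * ent g 1 2 - ent g 0 2 * ent g 1 1)).
    by rewrite /x; ring.
  by rewrite unitD; [rewrite unitrM => /andP[]|inP_tac].
have u1 g : (0 < M)%N -> g \in box a b c d -> ent g 1 1 \is a GRing.unit.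
  by move=> M0 gB; have [] := box_unit _ _ _ gB; [lia|lia|lia|].
split=> [g gB|g h gB hB].
  rewrite psiE mulf_neq0 //; first by apply: eta2_neq0 => M0; exact: u1.
  exact/eta3_neq0/u2.
have := gB; have := hB; move=> /boxP[h1 h2 h3 h4] /boxP[g1 g2 g3 g4].
by apply: psiM; rewrite ?u2 //; try (by move=> M0; rewrite !u1); inP_tac.
Qed.

End Setup.

(** * The inducing pair *)

Section AdditiveCharacter.
Variables (kF : finFieldType) (F : numFieldType) (w : kF -> F).
Hypotheses (w0 : w 0 = 1) (wD : forall a b, w (a + b) = w a * w b)
  (w_nt : exists a, w a != 1).

Lemma w_neq0 a : w a != 0.
Proof.
have := wD a (- a); rewrite subrr w0 => /esym e.
by apply: contra_eq_neq e => ->; rewrite mul0r eq_sym oner_eq0.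
Qed.

Lemma wN a : w (- a) = (w a)^-1.
Proof.
apply: (mulfI (w_neq0 a)); rewrite divff ?w_neq0 //.
by rewrite -wD subrr w0.
Qed.

Lemma w_sum c : \sum_a w (c * a) = if c == 0 then #|{: kF}|%:R else 0.
Proof.
have [->|c0] := eqVneq.
  rewrite (eq_bigr (fun=> 1)) ?sumr_const // => a _.
  by rewrite mul0r w0.
(* Translating the summation variable by b / c multiplies the sum by w b, which is not 1. *)
have [b wb] := w_nt; apply/eqP.
rewrite -(mulrI_eq0 _ (mulfI (_ : w b - 1 != 0))) ?subr_eq0 //.
rewrite mulrBl mul1r subr_eq0; apply/eqP.
rewrite [RHS](reindex_inj (addrI (b / c))) mulr_sumr; apply: eq_bigr => a _.
by rewrite mulrDr wD mulrCA divff // mulr1.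
Qed.

Lemma card_kF_neq0 : #|{: kF}|%:R != 0 :> F.
Proof. by rewrite pnatr_eq0 -lt0n; apply/card_gt0P; exists 0. Qed.

End AdditiveCharacter.

(** * The group H and its character theta *)

Section InducingPair.
Variables (k : padicField) (F : numFieldType) (chi2 chi3 : k -> F) (M N : nat).
Hypotheses (chi2_char : is_character chi2) (chi3_char : is_character chi3).
Hypotheses (chi2M : forall x, x \in unit_filtration M -> chi2 x = 1).
Hypotheses (chi3N : forall x, x \in unit_filtration N -> chi3 x = 1).
Hypotheses (leMN : (M <= N)%N) (N_gt0 : (0 < N)%N).
Notation R := (integers k).
Notation K := (GL3 k).
Notation kF := (residue_field k).
Notation res := (residue k).
Notation psi := (chi_c chi2 chi3 M).

Variables (m n : nat) (w : kF -> F).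
Hypotheses (leMm : (M <= m)%N) (leNn : (N <= n)%N).
Hypotheses (w0 : w 0 = 1) (wD : forall a b, w (a + b) = w a * w b)
  (w_nt : exists a, w a != 1).

(* From here on the parameters of the theorem are [m.+1] and [n.+1], and matrix
   indices start at 0.  When [m = 0], the bound on the entry (2,0) is relaxed to
   p^n at the cost of asking that the entry (0,1) be in p: this is what makes
   [Hgrp] stable under product. *)
Definition lev20 : nat := if m == 0%N then n else maxn n.+1 m.+1.
Definition lev01 : nat := (m == 0%N).
Notation top := (maxn n.+1 m.+1).

(** Gathering these inequalities lets m = 0 and m > 0 be treated together in most of what
    follows. *)
Lemma lev_bounds :
  [&& lev20 <= m + n, m < lev20, N <= lev20, n < lev20 + lev01,
      lev01 <= n, lev01 <= 1, 0 < m + lev01, 0 < n & top.-1 <= lev20 <= top]%N.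
Proof.
by rewrite /lev20 /lev01; case: (m =P 0%N) => m0 /=; do ?(apply/andP; split); lia.
Qed.

Definition Hgrp : {pred K} := fun g =>
  [&& g \in box m n lev20 lev01, ent g 0 0 - ent g 1 1 \in inP 1
    & ent g 1 1 - ent g 2 2 \in inP 1].

Lemma HgrpP g : reflect
  ([/\ ent g 1 0 \in inP m, ent g 2 1 \in inP n, ent g 2 0 \in inP lev20
    & ent g 0 1 \in inP lev01] /\
   (ent g 0 0 - ent g 1 1 \in inP 1 /\ ent g 1 1 - ent g 2 2 \in inP 1))
  (g \in Hgrp).
Proof.
by apply: (iffP and3P) => [[/boxP ? ? ?]|[/boxP ? [? ?]]].
Qed.

Lemma Hgrp_unit g : g \in Hgrp ->
  [/\ ent g 0 0 \is a GRing.unit, ent g 1 1 \is a GRing.unit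
    & ent g 2 2 \is a GRing.unit].
Proof.
move=> /and3P[gB _ _]; have lb := lev_bounds.
by apply: box_unit gB; lia.
Qed.

Lemma Hgrp_subgroup : is_subgroup Hgrp.
Proof.
have lb := lev_bounds.
have [B1 BV] : is_subgroup (@box k m n lev20 lev01) by apply: box_subgroup; lia.
have BM := subgroupM (conj B1 BV); have BV' := subgroupV (conj B1 BV).
apply: is_subgroupMV.
- by apply/and3P; rewrite B1 !ent1 /= subrr inP0.
- move=> g h gH hH; apply/and3P.
  have [[g1 g2 g3 g4] [g5 g6]] := HgrpP _ gH.
  have [[h1 h2 h3 h4] [h5 h6]] := HgrpP _ hH.
  split; first by apply: BM; [have /and3P[] := gH|have /and3P[] := hH].
    rewrite !entM.
    set x := (X in X \in _).
    have -> : x = ent g 0 0 * (ent h 0 0 - ent h 1 1) +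
      (ent g 0 0 - ent g 1 1) * ent h 1 1 + ent h 1 0 * ent g 0 1 -
      ent g 1 0 * ent h 0 1 + ent g 0 2 * ent h 2 0 - ent g 1 2 * ent h 2 1.
      by rewrite /x; ring.
    by inP_tac.
  rewrite !entM.
  set x := (X in X \in _).
  have -> : x = ent g 1 1 * (ent h 1 1 - ent h 2 2) +
      (ent g 1 1 - ent g 2 2) * ent h 2 2 + ent g 1 0 * ent h 0 1 +
      ent g 1 2 * ent h 2 1 - ent g 2 0 * ent h 0 2 - ent g 2 1 * ent h 1 2.
    by rewrite /x; ring.
  by inP_tac.
- move=> g gH; apply/and3P.
  have [[g1 g2 g3 g4] [g5 g6]] := HgrpP _ gH.
  split; first by apply: BV'; have /and3P[] := gH.
    rewrite !entV -mulrBr; apply: inPMl.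
    set x := (X in X \in _).
    have -> : x = - (ent g 0 0 - ent g 1 1) * ent g 2 2 - ent g 1 2 * ent g 2 1
      + ent g 0 2 * ent g 2 0.
      by rewrite /x; ring.
    by inP_tac.
  rewrite !entV -mulrBr; apply: inPMl.
  set x := (X in X \in _).
  have -> : x = - ent g 0 0 * (ent g 1 1 - ent g 2 2) + ent g 1 0 * ent g 0 1
      - ent g 0 2 * ent g 2 0.
    by rewrite /x; ring.
  by inP_tac.
Qed.

Definition theta (g : K) : F :=
  psi g * w (coef m (ent g 1 0) / res (ent g 0 0) + coef n (ent g 2 1) / res (ent g 1 1)).

Lemma Hgrp_res g : g \in Hgrp ->
  [/\ res (ent g 1 1) = res (ent g 0 0), res (ent g 2 2) = res (ent g 0 0)
    & res (ent g 0 0) != 0].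
Proof.
move=> gH; have [u0 u1 u2] := Hgrp_unit gH.
have [_ [g5 g6]] := HgrpP _ gH.
have e1 : res (ent g 1 1) = res (ent g 0 0) by apply/esym/eqP; rewrite res_eq.
split=> //; last by rewrite -unit_res.
by rewrite -e1; apply/esym/eqP; rewrite res_eq.
Qed.

Lemma Hgrp_sub_box : {subset Hgrp <= box m n lev20 lev01}.
Proof. by move=> g /and3P[]. Qed.

Lemma psi_Hgrp_mult : multiplicative_on Hgrp psi.
Proof.
have lb := lev_bounds.
have [p0 pM] : multiplicative_on (@box k m n lev20 lev01) psi.
  by apply: (psi_box_mult chi2_char chi3_char chi2M chi3N) => //; lia.
by split=> [g /Hgrp_sub_box|g h /Hgrp_sub_box gB /Hgrp_sub_box]; [exact: p0|exact: pM].
Qed.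

(** On H the three diagonal entries have the same residue, and the cross terms g_12 h_20 and g_20
    h_01 lie in p^(m+1) and p^(n+1). Hence the leading coefficients of the entries (1,0) and (2,1),
    divided by the diagonal, add up under products. *)
Lemma theta_mult : multiplicative_on Hgrp theta.
Proof.
have [p0 pM] := psi_Hgrp_mult.
split=> [g gH|g h gH hH]; first by rewrite mulf_neq0 ?p0 ?(w_neq0 w0 wD).
rewrite /theta pM // [RHS]mulrACA -wD; congr (_ * w _).
have lb := lev_bounds.
have [[g1 g2 g3 g4] [g5 g6]] := HgrpP _ gH.
have [[h1 h2 h3 h4] [h5 h6]] := HgrpP _ hH.
have [ge1 ge2 ge0] := Hgrp_res gH; have [he1 he2 he0] := Hgrp_res hH.
have ghH : (g * h)%g \in Hgrp by exact: (subgroupM Hgrp_subgroup).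
have [-> _ _] := Hgrp_res ghH; rewrite ge1 he1.
have -> : res (ent (g * h)%g 0 0) = res (ent g 0 0) * res (ent h 0 0).
  rewrite -rmorphM; apply/eqP; rewrite res_eq entM addrAC [X in X - _]addrC addrK.
  by inP_tac.
have -> : coef m (ent (g * h)%g 1 0) =
   coef m (ent g 1 0) * res (ent h 0 0) + res (ent g 0 0) * coef m (ent h 1 0).
  rewrite entM !coefD; [|inP_tac..].
  rewrite coefMr // coefMl // ge1 (coef_small (x := _ * ent h 2 0)) ?addr0 //.
  by inP_tac.
have -> : coef n (ent (g * h)%g 2 1) =
   coef n (ent g 2 1) * res (ent h 0 0) + res (ent g 0 0) * coef n (ent h 2 1).
  rewrite entM !coefD; [|inP_tac..].
  rewrite (coef_small (x := _ * ent h 0 1)); last by inP_tac.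
  by rewrite add0r coefMr // coefMl // ge2 he1.
by field; rewrite ge0 he0.
Qed.

End InducingPair.

(** * Self-intertwining of the inducing character *)

Section TestElements.
Variable k : padicField.
Notation R := (integers k).
Notation K := (GL3 k).
Implicit Types (g h : K) (i j a b : 'I_3) (y : R).

Definition col_test g i j y a b : R :=
  (if a == b then 1 else 0) + (if b == i then y * ent g a j else 0).

Definition row_test g i j y a b : R :=
  (if a == b then 1 else 0) + (if a == j then y * ent g i b else 0).

(* [1 + y g E_ji] and [1 + y E_ji g] are conjugate under [g]. *)
Lemma test_pair g i j y : 1 + y * ent g i j \is a GRing.unit ->
  exists h h', [/\ ent h = col_test g i j y, ent h' = row_test g i j y
    & (h * g = g * h')%g].
Proof.
move=> yU.
pose A : 'M[R]_3 := \matrix_(a, b) col_test g i j y a b.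
pose B : 'M[R]_3 := \matrix_(a, b) row_test g i j y a b.
have dA : det3 A = 1 + y * ent g i j.
  rewrite /det3 !mxE /col_test.
  by have [] := ord3P i => ->; have [] := ord3P j => -> /=; ring.
have dB : det3 B = 1 + y * ent g i j.
  rewrite /det3 !mxE /row_test.
  by have [] := ord3P i => ->; have [] := ord3P j => -> /=; ring.
have AU : A \in unitmx by rewrite unitmx3 // dA.
have BU : B \in unitmx by rewrite unitmx3 // dB.
have eA : ent (Sub A AU : K) = col_test g i j y.
  by apply/funext => a; apply/funext => b; rewrite /ent /= mxE.
have eB : ent (Sub B BU : K) = row_test g i j y.
  by apply/funext => a; apply/funext => b; rewrite /ent /= mxE.
exists (Sub A AU : K), (Sub B BU : K); split=> //.
apply: ent_ext => a b; rewrite !entM eA eB /col_test /row_test.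
by have [] := ord3P i => ->; have [] := ord3P j => ->;
   have [] := ord3P a => ->; have [] := ord3P b => -> /=; ring.
Qed.

End TestElements.

Section Mackey.
Variables (k : padicField) (F : numFieldType) (chi2 chi3 : k -> F) (M N : nat).
Hypotheses (chi2_char : is_character chi2) (chi3_char : is_character chi3).
Hypotheses (chi2M : forall x, x \in unit_filtration M -> chi2 x = 1).
Hypotheses (chi3N : forall x, x \in unit_filtration N -> chi3 x = 1).
Hypotheses (leMN : (M <= N)%N) (N_gt0 : (0 < N)%N).
Notation R := (integers k).
Notation K := (GL3 k).
Notation kF := (residue_field k).
Notation res := (residue k).
Notation psi := (chi_c chi2 chi3 M).

Variables (m n : nat) (w : kF -> F).
Hypotheses (leMm : (M <= m)%N) (leNn : (N <= n)%N).
Hypotheses (w0 : w 0 = 1) (wD : forall a b, w (a + b) = w a * w b)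
  (w_nt : exists a, w a != 1).

Notation Hgrp := (@Hgrp k m n).
Notation theta := (theta chi2 chi3 M m n w).
Notation lev20 := (lev20 m n).
Notation lev01 := (lev01 m).
Notation top := (maxn n.+1 m.+1).

Lemma w_line c : (forall a : R, w (res a * c) = 1) -> c = 0.
Proof.
move=> wc; apply/eqP/negPn/negP => c0; have [b] := w_nt.
have := wc (reslift (b / c)); rewrite reslift_id divfK // => ->.
by rewrite eqxx.
Qed.

(** Membership in H and, next, the value of theta as functions of an array of entries, so that test
    elements are handled through [col_test] and [row_test] alone. *)
Definition Hcond (A : 'I_3 -> 'I_3 -> R) : Prop :=
  [/\ A 1 0 \in inP m, A 2 1 \in inP n, A 2 0 \in inP lev20
    & A 0 1 \in inP lev01] /\
  (A 0 0 - A 1 1 \in inP 1 /\ A 1 1 - A 2 2 \in inP 1).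

Definition theta_of (A : 'I_3 -> 'I_3 -> R) : F :=
  eta2 chi2 M (A 1 1) * eta3 chi3 (A 2 2) *
  w (coef m (A 1 0) / res (A 0 0) + coef n (A 2 1) / res (A 1 1)).

Section Intertwining.
Variable g : K.
Hypothesis g_intertwines : forall h h', h \in Hgrp -> h' \in Hgrp ->
  (h * g)%g = (g * h')%g -> theta h = theta h'.

Lemma test_eq i j y : 1 + y * ent g i j \is a GRing.unit ->
  Hcond (col_test g i j y) -> Hcond (row_test g i j y) ->
  theta_of (col_test g i j y) = theta_of (row_test g i j y).
Proof.
move=> /test_pair[h [h' [hE h'E hg]]]; rewrite -hE -h'E => hH h'H.
by apply: g_intertwines => //; apply/HgrpP.
Qed.

Let add1K (x : R) : 1 + x - 1 = x. Proof. by rewrite addrAC subrr add0r. Qed.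
Let sub1D (x : R) : 1 - (1 + x) = - x. Proof. by rewrite opprD addrA subrr add0r. Qed.
Let coef0 j : coef j (0 : R) = 0. Proof. by rewrite coef_small // inP0. Qed.
Let entry_simp := (add0r, addr0, add1K, sub1D, subrr, coef0, mul0r,
  rmorph1, eta3_1 chi3N N_gt0, eta2_1 chi2M, w0, mul1r, mulr1, divr1).

Let res1D (x : R) : x \in inP 1 -> res (1 + x) = 1.
Proof. by move=> xP; apply/eqP; rewrite -(rmorph1 res) res_eq add1K. Qed.

Local Ltac feed H :=
  match type of H with
  | ?A -> _ => let h := fresh in assert (h : A); [|move: (H h) => {h} {}H]
  end.
Local Ltac test i j y E :=
  have E := @test_eq i j y;
  rewrite /Hcond /theta_of /col_test /row_test /= !entry_simp in E;
  feed E; [by apply: unit1D; inP_tac|];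
  feed E; [by do !split; inP_tac|];
  feed E; [by do !split; inP_tac|].

(* Each bound is obtained from the test pair at one position (i, j), with [y]
   running over the multiples of [unif ^+ s] by elements of the residue field. *)
Lemma bound_10 s : (0 < s)%N -> unif k ^+ s * ent g 1 0 \in inP m ->
  unif k ^+ s * ent g 2 0 \in inP lev20 -> unif k ^+ s * ent g 1 0 \in inP m.+1.
Proof.
move=> s0 a1 a2; have lb := lev_bounds leMN N_gt0 leMm leNn.
rewrite -coef_eq0 //; apply/eqP/w_line => a.
pose y := a * unif k ^+ s.
have yP : y \in inP s by rewrite /y mulrC inPX.
have y1 : y * ent g 1 0 \in inP m by rewrite -mulrA inPMl.
have y2 : y * ent g 2 0 \in inP lev20 by rewrite -mulrA inPMl.
test (0 : 'I_3) (0 : 'I_3) y E.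
rewrite res1D in E; last by inP_tac.
by rewrite -mulrA coefMl // divr1 in E.
Qed.

(** At the position (2,2) both sides carry the factor [eta3] of 1 + y g_22, which cancels. *)
Lemma bound_21 s : (0 < s)%N -> unif k ^+ s * ent g 2 1 \in inP n ->
  unif k ^+ s * ent g 2 0 \in inP lev20 -> unif k ^+ s * ent g 2 1 \in inP n.+1.
Proof.
move=> s0 a1 a2; have lb := lev_bounds leMN N_gt0 leMm leNn.
rewrite -coef_eq0 //; apply/eqP/w_line => a.
pose y := a * unif k ^+ s.
have yP : y \in inP s by rewrite /y mulrC inPX.
have y1 : y * ent g 2 1 \in inP n by rewrite -mulrA inPMl.
have y2 : y * ent g 2 0 \in inP lev20 by rewrite -mulrA inPMl.
test (2 : 'I_3) (2 : 'I_3) y E.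
have U : 1 + y * ent g 2 2 \is a GRing.unit by rewrite unit1D //; inP_tac.
have X0 := eta3_neq0 chi3_char U.
rewrite -coefMl // mulrA.
by move: E; rewrite -[LHS]mulr1 => /(mulfI X0) <-.
Qed.

(** The position (1,0) carries g_20 to the entry (2,1) of the column test, where theta reads it at
    level n. *)
Lemma bound_20_low s : unif k ^+ s * ent g 1 0 \in inP (maxn 1 M) ->
  unif k ^+ s * ent g 2 0 \in inP n -> (lev01 <= s)%N ->
  unif k ^+ s * ent g 2 0 \in inP n.+1.
Proof.
move=> a1 a2 s0; have lb := lev_bounds leMN N_gt0 leMm leNn.
rewrite -coef_eq0 //; apply/eqP/w_line => a.
pose y := a * unif k ^+ s.
have yP : y \in inP s by rewrite /y mulrC inPX.
have y1 : y * ent g 1 0 \in inP (maxn 1 M) by rewrite -mulrA inPMl.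
have y2 : y * ent g 2 0 \in inP n by rewrite -mulrA inPMl.
test (1 : 'I_3) (0 : 'I_3) y E.
rewrite res1D in E; last by inP_tac.
rewrite (eta2_1D chi2M) in E; last by inP_tac.
by rewrite -mulrA coefMl // divr1 mul1r in E.
Qed.

(** The position (2,1) carries g_20 to the entry (1,0) of the row test, where theta reads it at
    level m. *)
Lemma bound_20_high s : unif k ^+ s * ent g 2 1 \in inP N ->
  unif k ^+ s * ent g 2 0 \in inP m -> unif k ^+ s * ent g 2 0 \in inP m.+1.
Proof.
move=> a1 a2; have lb := lev_bounds leMN N_gt0 leMm leNn.
rewrite -coef_eq0 //; apply/eqP/w_line => a.
pose y := a * unif k ^+ s.
have y1 : y * ent g 2 1 \in inP N by rewrite -mulrA inPMl.
have y2 : y * ent g 2 0 \in inP m by rewrite -mulrA inPMl.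
test (2 : 'I_3) (1 : 'I_3) y E.
rewrite (eta2_1D chi2M) in E; last by inP_tac.
rewrite (eta3_1D chi3N N_gt0) in E; last by inP_tac.
by rewrite -mulrA coefMl // mul1r in E.
Qed.

(** The position (0,1) puts y g_11 and y g_00 in the entry (1,0) of the two tests, with y in p^m, so
    theta compares them modulo p. *)
Lemma diag_01 : unif k ^+ m * ent g 2 1 \in inP lev20 ->
  unif k ^+ m * ent g 0 1 \in inP 1 -> ent g 1 1 - ent g 0 0 \in inP 1.
Proof.
move=> a1 a2; have lb := lev_bounds leMN N_gt0 leMm leNn.
rewrite -res_eq0; apply/eqP/w_line => a.
pose y := a * unif k ^+ m.
have yP : y \in inP m by rewrite /y mulrC inPX.
have y1 : y * ent g 2 1 \in inP lev20 by rewrite -mulrA inPMl.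
have y2 : y * ent g 0 1 \in inP 1 by rewrite -mulrA inPMl.
test (0 : 'I_3) (1 : 'I_3) y E.
rewrite res1D // (eta2_1D chi2M) ?mul1r ?divr1 in E; last by inP_tac.
rewrite -rmorphM mulrBr rmorphB wD wN //.
have kE z : coef m (y * z) = res (a * z) by rewrite /y -mulrA mulrCA coefX.
by rewrite !kE in E; rewrite E divff // w_neq0.
Qed.

Lemma diag_12 : unif k ^+ n * ent g 1 0 \in inP lev20 ->
  ent g 2 2 - ent g 1 1 \in inP 1.
Proof.
move=> a1; have lb := lev_bounds leMN N_gt0 leMm leNn.
rewrite -res_eq0; apply/eqP/w_line => a.
pose y := a * unif k ^+ n.
have yP : y \in inP n by rewrite /y mulrC inPX.
have y1 : y * ent g 1 0 \in inP lev20 by rewrite -mulrA inPMl.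
test (1 : 'I_3) (2 : 'I_3) y E.
rewrite res1D ?(eta2_1D chi2M) ?(eta3_1D chi3N N_gt0) ?mul1r ?divr1 in E; try by inP_tac.
rewrite -rmorphM mulrBr rmorphB wD wN //.
have kE z : coef n (y * z) = res (a * z) by rewrite /y -mulrA mulrCA coefX.
by rewrite !kE in E; rewrite E divff // w_neq0.
Qed.

(** The position (0,2) puts y g_01 in the entry (2,1) of the row test; the entry (1,0) of the column
    test, y g_12, is negligible because n > 0. *)
Lemma bound_01 : m = 0%N -> ent g 0 1 \in inP 1.
Proof.
move=> m0; have lb := lev_bounds leMN N_gt0 leMm leNn.
have levE : lev20 = n by rewrite /lev20 m0.
rewrite -res_eq0; apply/eqP/w_line => a.
pose y := a * unif k ^+ n.
have yP : y \in inP n by rewrite /y mulrC inPX.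
test (0 : 'I_3) (2 : 'I_3) y E.
rewrite res1D ?(eta3_1D chi3N N_gt0) ?mul1r ?divr1 in E; try by inP_tac.
have kE z : coef n (y * z) = res (a * z) by rewrite /y -mulrA mulrCA coefX.
rewrite kE coef_small ?w0 in E; last by inP_tac.
by rewrite -rmorphM -E.
Qed.

Let unifX_unit j u : u \is a GRing.unit -> (unif k ^+ j * u \in inP j.+1) = false.
Proof. by rewrite -[j.+1]addn1 inPXD unit_res res_eq0 => /negPf. Qed.

(** Suppose g_20 has valuation i below its level. For m = 0, scaling it to valuation n contradicts
    [bound_20_low]. Otherwise the test at level max(m, n) can fail to apply only because g_10 (if m
    <= n) or g_21 (if n < m) has a small valuation j; scaling that entry to its own level then moves
    g_20 into p^lev20 and contradicts [bound_10] or [bound_21]. *)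
Lemma bound_20 : ent g 2 0 \in inP lev20.
Proof.
have lb := lev_bounds leMN N_gt0 leMm leNn.
apply/negPn/negP => /notin_inP[i [u [iL uU uE]]].
have [m0|m_gt0] := posnP m.
  have levE : lev20 = n by rewrite /lev20 m0.
  suff : unif k ^+ (n - i) * ent g 2 0 \in inP n.+1.
    by rewrite uE mulrA -exprD subnK ?unifX_unit //; lia.
  apply: bound_20_low; rewrite ?uE ?mulrA -?exprD; try by apply: inPX; lia.
  by rewrite /lev01 m0; lia.
have levE : lev20 = top by rewrite /lev20; case: eqP => // m0; lia.
have lev01E : lev01 = 0%N by rewrite /lev01; case: eqP => // m0; lia.
have [mn|nm] := leqP m n.
  have {}levE : lev20 = n.+1 by rewrite levE; lia.
  have : unif k ^+ (n - i) * ent g 1 0 \notin inP (maxn 1 M).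
    apply/negP => a1.
    suff : unif k ^+ (n - i) * ent g 2 0 \in inP n.+1.
      by rewrite uE mulrA -exprD subnK ?unifX_unit //; lia.
    by apply: bound_20_low; rewrite ?lev01E // uE mulrA -exprD inPX; lia.
  move=> a1; have : ent g 1 0 \notin inP m.
    by apply: contra a1 => a1; apply: inPMl; inP_tac.
  move=> /notin_inP[j [v [jm vU vE]]].
  have jM : (n - i + j < maxn 1 M)%N.
    by rewrite ltnNge; apply: contra a1 => a1; rewrite vE mulrA -exprD inPX.
  suff : unif k ^+ (m - j) * ent g 1 0 \in inP m.+1.
    by rewrite vE mulrA -exprD subnK ?unifX_unit //; lia.
  by apply: bound_10; rewrite ?vE ?uE ?mulrA -?exprD; [lia|apply: inPX; lia..].
have {}levE : lev20 = m.+1 by rewrite levE; lia.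
have a1 : unif k ^+ (m - i) * ent g 2 1 \notin inP N.
  apply/negP => a1.
  suff : unif k ^+ (m - i) * ent g 2 0 \in inP m.+1.
    by rewrite uE mulrA -exprD subnK ?unifX_unit //; lia.
  by apply: bound_20_high => //; rewrite uE mulrA -exprD inPX; lia.
have : ent g 2 1 \notin inP n.
  by apply: contra a1 => a1; apply: inPMl; inP_tac.
move=> /notin_inP[j [v [jm vU vE]]].
have jM : (m - i + j < N)%N.
  by rewrite ltnNge; apply: contra a1 => a1; rewrite vE mulrA -exprD inPX.
suff : unif k ^+ (n - j) * ent g 2 1 \in inP n.+1.
  by rewrite vE mulrA -exprD subnK ?unifX_unit //; lia.
by apply: bound_21; rewrite ?vE ?uE ?mulrA -?exprD; [lia|apply: inPX; lia..].
Qed.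

(** The entry (2,0) comes first, since the tests for (1,0) and (2,1) require a multiple of it to lie
    in p^lev20. An entry of too small valuation is scaled to valuation exactly m or n, against
    [bound_10] or [bound_21]. *)
Lemma intertwines_Hgrp : g \in Hgrp.
Proof.
have lb := lev_bounds leMN N_gt0 leMm leNn.
have a20 := bound_20.
have a10 : ent g 1 0 \in inP m.
  apply/negPn/negP => /notin_inP[j [v [jm vU vE]]].
  suff : unif k ^+ (m - j) * ent g 1 0 \in inP m.+1.
    by rewrite vE mulrA -exprD subnK ?unifX_unit //; lia.
  by apply: bound_10; rewrite ?vE ?mulrA -?exprD; [lia|apply: inPX; lia|exact: inPMl].
have a21 : ent g 2 1 \in inP n.
  apply/negPn/negP => /notin_inP[j [v [jm vU vE]]].
  suff : unif k ^+ (n - j) * ent g 2 1 \in inP n.+1.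
    by rewrite vE mulrA -exprD subnK ?unifX_unit //; lia.
  by apply: bound_21; rewrite ?vE ?mulrA -?exprD; [lia|apply: inPX; lia|exact: inPMl].
have pX j : unif k ^+ j \in inP j by rewrite -[X in X \in _]mulr1 inPX.
have pm := pX m; have pn := pX n.
have a01 : ent g 0 1 \in inP lev01.
  rewrite /lev01; case: eqP => m0; last exact: inP_0.
  exact: bound_01.
apply/HgrpP; split=> //; split; rewrite -inPN opprB.
  by apply: diag_01; inP_tac.
by apply: diag_12; inP_tac.
Qed.

End Intertwining.
End Mackey.

(** * The projection to the induced representation and its kernel *)

Section UnipotentElements.
Variable k : padicField.
Notation R := (integers k).
Notation K := (GL3 k).
Implicit Types (s r t : R).

(** The arguments are the entries (1,0), (2,0), (2,1). These elements form a Heisenberg group; the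
    twist t s' in [loM] is the source of the commutator corrections below. *)
Definition lo s r t : K := locked (fun s r t => GL3_of 1 0 0 s 1 0 r t 1 : K) s r t.
Arguments lo (s r t)%_R.

Lemma loE s r t (A := ent (lo s r t)) :
  ((A 0 0 = 1) * (A 0 1 = 0) * (A 0 2 = 0) *
   (A 1 0 = s) * (A 1 1 = 1) * (A 1 2 = 0) *
   (A 2 0 = r) * (A 2 1 = t) * (A 2 2 = 1))%type.
Proof.
rewrite /A /lo -lock; apply: ent_GL3_of; set x := (X in X \is a _).
have -> : x = 1 by rewrite /x; ring.
exact: unitr1.
Qed.

Lemma loM s r t s' r' t' :
  (lo s r t * lo s' r' t')%g = lo (s + s') (r + t * s' + r') (t + t').
Proof. by apply: ent_ext9; rewrite entM !loE; ring. Qed.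

Lemma lo1 : lo 0 0 0 = 1%g.
Proof. by apply: ent_ext9; rewrite loE ent1. Qed.

Lemma loV s r t : (lo s r t)^-1%g = lo (- s) (t * s - r) (- t).
Proof.
apply: (mulgI (lo s r t)); rewrite mulgV loM -lo1.
by congr lo; ring.
Qed.

Lemma lo_box a b c s r t :
  (lo s r t \in box a b c 0) = [&& s \in inP a, t \in inP b & r \in inP c].
Proof.
apply/boxP/and3P; rewrite !loE => -[h1 h2 h3]; split=> //.
exact: inP_0.
Qed.

Lemma reslift_inj j (a b : residue_field k) : 
  unif k ^+ j * reslift a - unif k ^+ j * reslift b \in inP j.+1 -> a = b.
Proof.
rewrite -mulrBr -[j.+1]addn1 inPXD -res_eq0 rmorphB !reslift_id subr_eq0.
by move/eqP.
Qed.

(** Subtracting one digit of x / u raises the level by one; this is how coset representatives are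
    found. *)
Lemma reslift_div j (x u : R) : x \in inP j -> u \is a GRing.unit ->
  x - u * (unif k ^+ j * reslift (coef j x / residue k u)) \in inP j.+1.
Proof.
move=> xP uU; rewrite -coef_eq0; last by inP_tac.
rewrite mulrCA -mulrN coefD ?inPX // coefX rmorphN rmorphM reslift_id.
by rewrite mulrCA divff -?unit_res // mulr1 subrr.
Qed.

End UnipotentElements.
Arguments lo {k} (s r t)%_R.

(** * Averages along one lower unipotent coordinate *)

Section PsiLo.
Variables (k : padicField) (F : numFieldType) (chi2 chi3 : k -> F) (M N : nat).
Hypotheses (chi2_char : is_character chi2) (chi3_char : is_character chi3).
Hypotheses (chi2M : forall x, x \in unit_filtration M -> chi2 x = 1).
Hypotheses (chi3N : forall x, x \in unit_filtration N -> chi3 x = 1).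
Hypotheses (leMN : (M <= N)%N) (N_gt0 : (0 < N)%N).
Notation R := (integers k).
Notation K := (GL3 k).
Notation kF := (residue_field k).
Notation res := (residue k).
Notation psi := (chi_c chi2 chi3 M).

Lemma psi_lo (s r t : R) : psi (lo s r t) = 1.
Proof. by rewrite psiE !loE (eta2_1 chi2M) (eta3_1 chi3N N_gt0) mulr1. Qed.

(** Sums over representatives of p^j / p^(j+1) in a single lower entry, not divided by q; they lower
    the level of that entry from j+1 to j. *)
Definition av21 b (f : K -> F) (x : K) : F :=
  \sum_(t : kF) f (lo 0 0 (unif k ^+ b * reslift t) * x)%g.
Definition av10 a (f : K -> F) (x : K) : F :=
  \sum_(s : kF) f (lo (unif k ^+ a * reslift s) 0 0 * x)%g.
Definition av20 c (f : K -> F) (x : K) : F :=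
  \sum_(r : kF) f (lo 0 (unif k ^+ c * reslift r) 0 * x)%g.

Lemma average_box (a b c d a' b' c' d' : nat) (r : kF -> K) (f : K -> F) :
  is_subgroup (@box k a' b' c' d') -> is_subgroup (@box k a b c d) ->
  (N <= b)%N -> (N <= c)%N -> (M <= a + d)%N ->
  [/\ a <= a', b <= b', c <= c' & d <= d']%N ->
  (forall i, psi (r i) = 1) ->
  coset_transversal (box a' b' c' d') (box a b c d) r ->
  equivariant (box a' b' c' d') psi f ->
  equivariant (box a b c d) psi (fun x => \sum_i f (r i * x)%g).
Proof.
move=> gC gD Nb Nc Mad [aa bb cc dd] r1 tr fC h x hD.
have sub : {subset @box k a' b' c' d' <= box a b c d}.
  by move=> g /boxP[g1 g2 g3 g4]; apply/boxP; split; inP_tac.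
have pm : multiplicative_on (@box k a b c d) psi.
  exact: (psi_box_mult chi2_char chi3_char chi2M chi3N).
have := average_equivariant gC gD sub pm tr fC x hD.
under eq_bigr do rewrite r1 invr1 mul1r.
by under [X in _ = _ * X -> _]eq_bigr do rewrite r1 invr1 mul1r.
Qed.

(** The strict inequality b < c + d keeps the box with exponent b+1 a group; its cosets are
    separated by the leading coefficient of h_21 / h_22. *)
Lemma av21_equivariant a b c d f : (c <= a + b)%N -> (b < c + d)%N ->
  (a <= c)%N -> (d <= b)%N -> (0 < a + d)%N ->
  (N <= b)%N -> (N <= c)%N -> (M <= a + d)%N ->
  equivariant (box a b.+1 c d) psi f -> equivariant (box a b c d) psi (av21 b f).
Proof.
move=> h1 h2 h3 h4 h5 Nb Nc Mad.
apply: (average_box (r := fun t : kF => lo 0 0 (unif k ^+ b * reslift t))) => //;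
  try (by apply: box_subgroup; lia).
- by move=> i; rewrite psi_lo.
- split.
  + by move=> t; apply/boxP; rewrite !loE; split; inP_tac.
  + move=> h hB; have [|||u0 u1 u2] := box_unit _ _ _ hB; [lia|lia|lia|].
    have [g1 g2 g3 g4] := boxP _ _ _ _ _ hB.
    exists (coef b (ent h 2 1) / res (ent h 2 2)).
    have tP := reslift_div g2 u2.
    set t := unif k ^+ b * _ in tP *.
    have tb : t \in inP b by exact: inPX.
    apply/boxP; rewrite loV !entM !loE; split;
      rewrite ?(mulr0, mulr1, addr0, add0r, mulrN, oppr0, subr0) //; inP_tac.
  + move=> i j /boxP[_ + _ _]; rewrite loV loM loE; exact: reslift_inj.
Qed.

Lemma av10_equivariant a b c d f : (c <= a + b)%N -> (b <= c + d)%N ->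
  (a < c)%N -> (d <= b)%N -> (0 < a + d)%N ->
  (N <= b)%N -> (N <= c)%N -> (M <= a + d)%N ->
  equivariant (box a.+1 b c d) psi f -> equivariant (box a b c d) psi (av10 a f).
Proof.
move=> h1 h2 h3 h4 h5 Nb Nc Mad.
apply: (average_box (r := fun t : kF => lo (unif k ^+ a * reslift t) 0 0)) => //;
  try (by apply: box_subgroup; lia).
- by move=> i; rewrite psi_lo.
- split.
  + by move=> t; apply/boxP; rewrite !loE; split; inP_tac.
  + move=> h hB; have [|||u0 u1 u2] := box_unit _ _ _ hB; [lia|lia|lia|].
    have [g1 g2 g3 g4] := boxP _ _ _ _ _ hB.
    exists (coef a (ent h 1 0) / res (ent h 1 1)).
    have tP := reslift_div g1 u1.
    set t := unif k ^+ a * _ in tP *.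
    have tb : t \in inP a by exact: inPX.
    apply/boxP; rewrite loV !entM !loE; split;
      rewrite ?(mulr0, mul0r, mulr1, addr0, add0r, mulrN, oppr0, subr0) //; inP_tac.
  + move=> i j /boxP[+ _ _ _]; rewrite loV loM loE; exact: reslift_inj.
Qed.

Lemma av20_equivariant a b c d f : (c < a + b)%N -> (b <= c + d)%N ->
  (a <= c)%N -> (d <= b)%N -> (0 < a + d)%N ->
  (N <= b)%N -> (N <= c)%N -> (M <= a + d)%N ->
  equivariant (box a b c.+1 d) psi f -> equivariant (box a b c d) psi (av20 c f).
Proof.
move=> h1 h2 h3 h4 h5 Nb Nc Mad.
apply: (average_box (r := fun t : kF => lo 0 (unif k ^+ c * reslift t) 0)) => //;
  try (by apply: box_subgroup; lia).
- by move=> i; rewrite psi_lo.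
- split.
  + by move=> t; apply/boxP; rewrite !loE; split; inP_tac.
  + move=> h hB; have [|||u0 u1 u2] := box_unit _ _ _ hB; [lia|lia|lia|].
    have [g1 g2 g3 g4] := boxP _ _ _ _ _ hB.
    exists (coef c (ent h 2 0) / res (ent h 2 2)).
    have tP := reslift_div g3 u2.
    set t := unif k ^+ c * _ in tP *.
    have tb : t \in inP c by exact: inPX.
    apply/boxP; rewrite loV !entM !loE; split;
      rewrite ?(mulr0, mul0r, mulr1, addr0, add0r, sub0r, mulrN, oppr0, subr0) //; inP_tac.
  + move=> i j /boxP[_ _ + _].
    by rewrite loV loM loE !(mulr0, mul0r, addr0, add0r, sub0r); exact: reslift_inj.
Qed.

Lemma smooth_left_sum (I : finType) (P : pred I) (coef : I -> F) (r : I -> K)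
    (f : K -> F) :
  smooth f -> smooth (fun x => \sum_(i | P i) coef i * f (r i * x)%g).
Proof.
move=> [l fl]; exists l => x g gl; apply: eq_bigr => i _.
by rewrite mulgA (fl _ g gl).
Qed.

Lemma smooth_av21 b f : smooth f -> smooth (av21 b f).
Proof.
move=> fs; have := smooth_left_sum predT (fun=> 1)
  (fun t : kF => lo 0 0 (unif k ^+ b * reslift t)) fs.
by congr smooth; apply/funext => x; apply: eq_bigr => t _; rewrite mul1r.
Qed.

Lemma smooth_av10 a f : smooth f -> smooth (av10 a f).
Proof.
move=> fs; have := smooth_left_sum predT (fun=> 1)
  (fun t : kF => lo (unif k ^+ a * reslift t) 0 0) fs.
by congr smooth; apply/funext => x; apply: eq_bigr => t _; rewrite mul1r.
Qed.

Lemma smooth_av20 c f : smooth f -> smooth (av20 c f).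
Proof.
move=> fs; have := smooth_left_sum predT (fun=> 1)
  (fun t : kF => lo 0 (unif k ^+ c * reslift t) 0) fs.
by congr smooth; apply/funext => x; apply: eq_bigr => t _; rewrite mul1r.
Qed.

Lemma smooth_lin (a b : F) (f1 f2 : K -> F) : smooth f1 -> smooth f2 ->
  smooth (fun x => a * f1 x + b * f2 x).
Proof.
move=> [l1 f1l] [l2 f2l]; exists (maxn l1 l2) => x g gl.
rewrite (f1l x) ?(f2l x) //; by rewrite (congruence_subgroup_le _ gl) ?leq_maxl ?leq_maxr.
Qed.

Lemma smooth_left (r : K) (f : K -> F) : smooth f -> smooth (fun x => f (r * x)%g).
Proof. by move=> [l fl]; exists l => x g gl; rewrite mulgA (fl _ g gl). Qed.

Lemma U_P c f : f \in U_ chi2 chi3 M c <->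
  equivariant (box (tr1 c) (tr2 c) (tr3 c) 0) psi f /\ smooth f.
Proof.
split=> [/asboolP[fC fs]|[fC fs]]; first by split=> // h x; rewrite -C_box; exact: fC.
by apply/asboolP; split=> // h x; rewrite C_box; exact: fC.
Qed.

End PsiLo.

(** * The projection L and its equivariance *)

Section Projection.
Variables (k : padicField) (F : numFieldType) (chi2 chi3 : k -> F) (M N : nat).
Hypotheses (chi2_char : is_character chi2) (chi3_char : is_character chi3).
Hypotheses (chi2M : forall x, x \in unit_filtration M -> chi2 x = 1).
Hypotheses (chi3N : forall x, x \in unit_filtration N -> chi3 x = 1).
Hypotheses (leMN : (M <= N)%N) (N_gt0 : (0 < N)%N).
Notation R := (integers k).
Notation K := (GL3 k).
Notation kF := (residue_field k).
Notation res := (residue k).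
Notation psi := (chi_c chi2 chi3 M).

Variables (m n : nat) (w : kF -> F).
Hypotheses (leMm : (M <= m)%N) (leNn : (N <= n)%N).
Hypotheses (w0 : w 0 = 1) (wD : forall a b, w (a + b) = w a * w b)
  (w_nt : exists a, w a != 1).

Notation Hgrp := (@Hgrp k m n).
Notation theta := (theta chi2 chi3 M m n w).
Notation lev20 := (lev20 m n).
Notation lev01 := (lev01 m).
Notation top := (maxn n.+1 m.+1).

Definition rep3 (s r t : kF) : K :=
  lo (unif k ^+ m * reslift s) (unif k ^+ lev20 * reslift r) (unif k ^+ n * reslift t).

(* For [a = b = 1] this is, up to a scalar, the average over [Hgrp] against
   [theta]; the redundant sum over [r] when [m > 0] allows a uniform treatment. *)
Definition L_ (a b : kF) (f : K -> F) (x : K) : F :=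
  \sum_s \sum_r \sum_t w (- (a * s + b * t)) * f (rep3 s r t * x)%g.

(** One element times the inverse of the other has (2,0) entry (r - r') - (t - t') s', so the
    congruences put it in C_c, and [psi] is 1 on lower unipotent elements. *)
Lemma lo_cong (f : K -> F) x (s r t s' r' t' : R) :
  equivariant (box m.+1 n.+1 top 0) psi f ->
  s - s' \in inP m.+1 -> t - t' \in inP n.+1 -> r - r' \in inP top ->
  s' \in inP m -> f (lo s r t * x)%g = f (lo s' r' t' * x)%g.
Proof.
move=> fC hs ht hr hs'.
rewrite -[lo s r t](mulgVK (lo s' r' t')) -mulgA loV loM.
rewrite fC ?(psi_lo chi2M chi3N) ?mul1r //.
rewrite lo_box hs ht /=.
have -> : r + t * - s' + (t' * s' - r') = (r - r') - (t - t') * s' by ring.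
by inP_tac.
Qed.

Lemma rep3_res (f : K -> F) x (s r t : R) :
  equivariant (box m.+1 n.+1 top 0) psi f ->
  f (lo (unif k ^+ m * s) (unif k ^+ lev20 * r) (unif k ^+ n * t) * x)%g =
  f (rep3 (res s) (res r) (res t) * x)%g.
Proof.
move=> fC; have lb := lev_bounds leMN N_gt0 leMm leNn.
have P j (z : R) : unif k ^+ j * z - unif k ^+ j * reslift (res z) \in inP j.+1.
  by rewrite -mulrBr -[j.+1]addn1 inPXD -res_eq reslift_id.
apply: lo_cong => //; try exact: P; last by exact: inPX.
by apply: inPW (P _ _); lia.
Qed.

Lemma rep3_Hgrp s r t : rep3 s r t \in Hgrp.
Proof. by apply/HgrpP; rewrite !loE !subrr !inP0 !inPX. Qed.

Lemma theta_rep3 s r t : theta (rep3 s r t) = w (s + t).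
Proof.
rewrite /theta (psi_lo chi2M chi3N) // !loE !coefX !reslift_id rmorph1 !divr1.
by rewrite mul1r.
Qed.

(** One power of p deeper than H in each lower entry: this subgroup lies in C_c and [theta] agrees
    with [psi] on it. *)
Definition Hcore : {pred K} :=
  [predI box m.+1 n.+1 lev20.+1 lev01 & Hgrp].

Lemma Hcore_subgroup : is_subgroup Hcore.
Proof.
have lb := lev_bounds leMN N_gt0 leMm leNn.
apply: subgroupI; last exact: (Hgrp_subgroup k leMN N_gt0 leMm leNn).
by apply: box_subgroup; lia.
Qed.

Lemma Hcore_transversal :
  coset_transversal Hcore Hgrp (fun i : kF * kF * kF => rep3 i.1.1 i.1.2 i.2).
Proof.
have lb := lev_bounds leMN N_gt0 leMm leNn.
have gH := Hgrp_subgroup k leMN N_gt0 leMm leNn.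
split=> [i|h hH|[[s r] t] [[s' r'] t'] /andP[/boxP[+ + + _] _]]; first exact: rep3_Hgrp.
  have [u0 u1 u2] := Hgrp_unit leMN N_gt0 leMm leNn hH.
  have [[g1 g2 g3 g4] [g5 g6]] := HgrpP _ _ _ hH.
  pose s := coef m (ent h 1 0) / res (ent h 1 1).
  pose t := coef n (ent h 2 1) / res (ent h 2 2).
  have sP := reslift_div g1 u1; have tP := reslift_div g2 u2.
  rewrite -/s in sP; rewrite -/t in tP.
  set S := unif k ^+ m * _ in sP; set T := unif k ^+ n * _ in tP.
  have SP : S \in inP m by exact: inPX.
  have TP : T \in inP n by exact: inPX.
  (* What remains of the entry (2,0) after clearing by S and T; the commutator term T S keeps it in
     p^lev20, so r can be read off from it. *)
  have g3' : ent h 2 0 - ent h 2 1 * S + ent h 2 2 * (T * S) \in inP lev20 by inP_tac.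
  have rP := reslift_div g3' u2.
  set r := coef _ _ / _ in rP.
  set Q := unif k ^+ lev20 * _ in rP.
  have QP : Q \in inP lev20 by exact: inPX.
  exists (s, r, t); apply/andP; split; last first.
    by apply: gH.2 => //; exact: rep3_Hgrp.
  apply/boxP; rewrite loV !entM !loE -/S -/T -/Q; split.
  - have -> : ent h 1 0 * 1 + ent h 1 1 * - S + ent h 1 2 * (T * S - Q) =
      (ent h 1 0 - ent h 1 1 * S) + ent h 1 2 * (T * S - Q) by ring.
    by inP_tac.
  - have -> : ent h 2 0 * 0 + ent h 2 1 * 1 + ent h 2 2 * - T =
      ent h 2 1 - ent h 2 2 * T by ring.
    by inP_tac.
  - have -> : ent h 2 0 * 1 + ent h 2 1 * - S + ent h 2 2 * (T * S - Q) =
      ent h 2 0 - ent h 2 1 * S + ent h 2 2 * (T * S) - ent h 2 2 * Q by ring.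
    by inP_tac.
  - by rewrite mulr0 mulr1 add0r; inP_tac.
have rE (x y z u : R) : x + y * - z + (y * z - u) = x - u by ring.
rewrite loV loM !loE /= => /reslift_inj <- /reslift_inj <-.
by rewrite rE => /reslift_inj <-.
Qed.

(** [L_ 1 1] is the average from [Hcore] to [Hgrp] against theta, since theta takes the value w (s +
    t) on the representatives. *)
Lemma L_equivariant f : equivariant (box m.+1 n.+1 top 0) psi f ->
  equivariant Hgrp theta (L_ 1 1 f).
Proof.
move=> fC; have lb := lev_bounds leMN N_gt0 leMm leNn.
have fcore : equivariant Hcore theta f.
  move=> h x /andP[/boxP[h1 h2 h3 h4] hH].
  rewrite fC; last by apply/boxP; split; inP_tac.
  congr (_ * _); rewrite /theta !coef_small //.
  by rewrite !mul0r addr0 w0 mulr1.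
have sub : {subset Hcore <= Hgrp} by move=> h /andP[].
have := average_equivariant Hcore_subgroup
  (Hgrp_subgroup k leMN N_gt0 leMm leNn) sub
  (theta_mult chi2_char chi3_char chi2M chi3N leMN N_gt0 leMm leNn w0 wD)
  Hcore_transversal fcore.
set g := (X in equivariant _ _ X); suff -> : g = L_ 1 1 f by [].
apply/funext => x; rewrite /g /L_ !pair_bigA; apply: eq_bigr => -[[s r] t] _ /=.
by rewrite theta_rep3 !mul1r wN.
Qed.

(* Torus elements permute the pairs of nontrivial characters transitively. *)
Lemma L_torus a b f : equivariant (box m.+1 n.+1 top 0) psi f ->
  a != 0 -> b != 0 -> (forall x, L_ 1 1 f x = 0) -> forall x, L_ a b f x = 0.
Proof.
move=> fC a0 b0 Lf x; have lb := lev_bounds leMN N_gt0 leMm leNn.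
pose A := reslift a^-1; pose B := reslift b^-1.
have AU : A \is a GRing.unit by rewrite unit_res reslift_id invr_eq0.
have BU : B \is a GRing.unit by rewrite unit_res reslift_id invr_eq0.
have dU : A * B * (B * 1 - 0 * 0) - 0 * (0 * 1 - 0 * 0) +
    0 * (0 * 0 - B * 0) \is a GRing.unit.
  by rewrite !(mul0r, mulr0, subr0, addr0, mulr1) !unitrM AU BU.
(* Conjugation by diag(AB, B, 1) scales s, r, t by A, AB, B, so reindexing turns the characters (1,
   1) into (a, b). *)
pose tau : K := GL3_of (A * B) 0 0 0 B 0 0 0 1.
have tauE := ent_GL3_of dU; rewrite -/tau in tauE.
have tC : tau \in box m.+1 n.+1 top 0.
  by apply/boxP; rewrite !tauE !inP0.
have lo_tau (s r t : R) : (lo s r t * tau = tau * lo (s * A) (r * (A * B)) (t * B))%g.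
  by apply: ent_ext9; rewrite !entM !tauE !loE; ring.
have p0 : psi tau != 0.
  rewrite psiE !tauE mulf_neq0 ?eta3_neq0 ?unitr1 //.
  by apply: eta2_neq0.
apply: (mulfI p0); rewrite mulr0 -(Lf (tau * x)%g) /L_ mulr_sumr.
rewrite [RHS](reindex_inj (mulfI a0)); apply: eq_bigr => s _ /=.
have ab0 : a * b != 0 by rewrite mulf_neq0.
rewrite mulr_sumr [RHS](reindex_inj (mulfI ab0)); apply: eq_bigr => r _ /=.
rewrite mulr_sumr [RHS](reindex_inj (mulfI b0)); apply: eq_bigr => t _ /=.
rewrite !mul1r mulrCA; congr (_ * _).
rewrite [in RHS]mulgA [in RHS]/rep3 lo_tau -mulgA (fC _ _ tC); congr (_ * _).
rewrite -!mulrA [RHS]rep3_res // !rmorphM !reslift_id.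
congr (f (rep3 _ _ _ * x)%g); field; rewrite ?a0 ?b0 //.
Qed.

End Projection.

(** * Functions killed by L, and one that is not *)

Section Projection.
Variables (k : padicField) (F : numFieldType) (chi2 chi3 : k -> F) (M N : nat).
Hypotheses (chi2_char : is_character chi2) (chi3_char : is_character chi3).
Hypotheses (chi2M : forall x, x \in unit_filtration M -> chi2 x = 1).
Hypotheses (chi3N : forall x, x \in unit_filtration N -> chi3 x = 1).
Hypotheses (leMN : (M <= N)%N) (N_gt0 : (0 < N)%N).
Notation R := (integers k).
Notation K := (GL3 k).
Notation kF := (residue_field k).
Notation res := (residue k).
Notation psi := (chi_c chi2 chi3 M).

Variables (m n : nat) (w : kF -> F).
Hypotheses (leMm : (M <= m)%N) (leNn : (N <= n)%N).
Hypotheses (w0 : w 0 = 1) (wD : forall a b, w (a + b) = w a * w b)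
  (w_nt : exists a, w a != 1).

Notation Hgrp := (@Hgrp k m n).
Notation theta := (theta chi2 chi3 M m n w).
Notation lev20 := (lev20 m n).
Notation lev01 := (lev01 m).
Notation top := (maxn n.+1 m.+1).

Let sum_wN : \sum_t w (- t) = 0.
Proof.
have := w_sum w0 wD w_nt (-1); rewrite oppr_eq0 oner_eq0 => e.
by rewrite -[RHS]e; apply: eq_bigr => t _; rewrite mulN1r.
Qed.

Local Notation L_ := (L_ m n w).

(** The coordinate s can be taken leftmost, where equivariance at level m absorbs it; the sum of the
    w (- s), which is 0, factors out. *)
Lemma L_vanish_10 f x : equivariant (box m n.+1 top 0) psi f -> L_ 1 1 f x = 0.
Proof.
move=> fE; have lb := lev_bounds leMN N_gt0 leMm leNn.
pose X := \sum_r \sum_t w (- t) * f (rep3 m n 0 r t * x)%g.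
rewrite (_ : L_ 1 1 f x = \sum_s w (- s) * X); first by rewrite -mulr_suml sum_wN mul0r.
apply: eq_bigr => s _; rewrite mulr_sumr; apply: eq_bigr => r _.
rewrite mulr_sumr; apply: eq_bigr => t _.
rewrite !mul1r opprD wD mulrA; congr (_ * _).
pose S := unif k ^+ m * reslift s - unif k ^+ m * reslift 0.
have -> : rep3 m n s r t = (lo S 0 0 * rep3 m n 0 r t)%g.
  by rewrite /rep3 loM; congr lo; rewrite /S; ring.
rewrite -mulgA fE ?(psi_lo chi2M chi3N) ?mul1r //.
by rewrite lo_box /S -mulrBr inPX // !inP0.
Qed.

(** Moving t to the left of s produces the commutator t s in the entry (2,0), of level m + n; a
    shift of r absorbs it and the sum of the w (- t) factors out. *)
Lemma L_vanish_21 f x : equivariant (box m.+1 n top 0) psi f -> L_ 1 1 f x = 0.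
Proof.
move=> fE; have lb := lev_bounds leMN N_gt0 leMm leNn.
have fC : equivariant (box m.+1 n.+1 top 0) psi f.
  by apply: equivariant_box_le fE; split.
pose S s : R := unif k ^+ m * reslift s.
pose X s := \sum_r f (rep3 m n 0 r 0 * (lo (S s) 0 0 * x))%g.
rewrite (_ : L_ 1 1 f x = \sum_s w (- s) * ((\sum_t w (- t)) * X s)).
  by rewrite big1 // => s _; rewrite sum_wN mul0r mulr0.
apply: eq_bigr => s _; rewrite exchange_big /= mulr_suml mulr_sumr.
apply: eq_bigr => t _; rewrite /X.
pose D := unif k ^+ (m + n - lev20) * (reslift t * reslift s).
rewrite [in RHS](reindex_inj (addIr (- res D))) !mulr_sumr; apply: eq_bigr => r _ /=.
rewrite !mul1r opprD wD -mulrA; congr (_ * (_ * _)).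
pose T := unif k ^+ n * reslift t.
have RE : unif k ^+ lev20 * reslift r = unif k ^+ lev20 * (reslift r - D) + T * S s.
  have DE : unif k ^+ lev20 * D = unif k ^+ m * unif k ^+ n * (reslift t * reslift s).
    by rewrite /D mulrA -!exprD subnKC //; lia.
  by rewrite mulrBr DE /T /S; ring.
have -> : rep3 m n s r t =
    (lo 0 0 T * lo 0 (unif k ^+ lev20 * (reslift r - D)) 0 * lo (S s) 0 0)%g.
  by rewrite /rep3 RE !loM; congr lo; rewrite /S /T; ring.
rewrite -!mulgA fE; last by rewrite lo_box /T inPX // !inP0.
rewrite (psi_lo chi2M chi3N) // mul1r.
have := rep3_res chi2M chi3N leMN N_gt0 leMm leNn
  (lo (S s) 0 0 * x)%g 0 (reslift r - D) 0 fC.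
by rewrite !mulr0 rmorph0 rmorphB reslift_id.
Qed.

(** A vector of U_c with nonzero image under L, which shows that V_c is not zero. *)
Definition delta (g : K) : F := if g \in box m.+1 n.+1 top 0 then psi g else 0.

Lemma delta_equivariant : equivariant (box m.+1 n.+1 top 0) psi delta.
Proof.
have lb := lev_bounds leMN N_gt0 leMm leNn.
have gC : is_subgroup (@box k m.+1 n.+1 top 0) by apply: box_subgroup; lia.
have [p0 pM] : multiplicative_on (@box k m.+1 n.+1 top 0) psi.
  by apply: (psi_box_mult chi2_char chi3_char chi2M chi3N) => //; lia.
move=> h x hC; rewrite /delta.
have -> : (h * x)%g \in box m.+1 n.+1 top 0 = (x \in box m.+1 n.+1 top 0).
  apply/idP/idP => [hx|xC]; last exact: (subgroupM gC).
  by rewrite -[x](mulKg h); apply: (subgroupM gC) => //; exact: (subgroupV gC).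
by case: ifP => xC; rewrite ?mulr0 // pM.
Qed.

Lemma congruence_box l g : (top <= l)%N -> g \in congruence_subgroup l ->
  g \in box m.+1 n.+1 top 0 /\ psi g = 1.
Proof.
move=> tl /forallP gl.
have gE i j : ent g i j - (if i == j then 1 else 0) \in inP l.
  have /forallP/(_ j) := gl i; rewrite /entry.
  by rewrite unfold_in /inP /=; case: (i == j).
have := gE 1 0; have := gE 2 1; have := gE 2 0; have := gE 1 1; have := gE 2 2.
rewrite /= !subr0 => g22 g11 g20 g21 g10; split.
  by apply/boxP; split; inP_tac.
rewrite psiE -(subrK 1 (ent g 1 1)) -(subrK 1 (ent g 2 2)) ![_ - 1 + 1]addrC.
by rewrite (eta2_1D chi2M) ?(eta3_1D chi3N) ?mulr1 //; inP_tac.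
Qed.

Lemma delta_smooth : smooth delta.
Proof.
have lb := lev_bounds leMN N_gt0 leMm leNn.
have gC : is_subgroup (@box k m.+1 n.+1 top 0) by apply: box_subgroup; lia.
have [p0 pM] : multiplicative_on (@box k m.+1 n.+1 top 0) psi.
  by apply: (psi_box_mult chi2_char chi3_char chi2M chi3N) => //; lia.
exists top => x g /(congruence_box (leqnn _))[gB pg].
rewrite /delta.
have -> : (x * g)%g \in box m.+1 n.+1 top 0 = (x \in box m.+1 n.+1 top 0).
  apply/idP/idP => [hx|xC]; last exact: (subgroupM gC).
  by rewrite -[x](mulgK g); apply: (subgroupM gC) => //; exact: (subgroupV gC).
by case: ifP => xC //; rewrite pM // pg mulr1.
Qed.

Lemma L_delta : L_ 1 1 delta 1%g != 0.
Proof.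
have lb := lev_bounds leMN N_gt0 leMm leNn.
(* Each term is 0 or 1, so the sum is a natural number, positive because of the term at (0, 0,
   0). *)
pose B s r t := rep3 m n s r t \in @box k m.+1 n.+1 top 0.
have dE s r t : w (- (1 * s + 1 * t)) * delta (rep3 m n s r t * 1)%g = (B s r t : nat)%:R.
  rewrite mulg1 /delta -/(B s r t).
  case: ifP => [|_]; last by rewrite mulr0.
  rewrite /B /rep3 lo_box => /and3P[hs ht _].
  have z j (a : kF) : unif k ^+ j * reslift a \in inP j.+1 -> a = 0.
    by rewrite -addn1 inPXD -res_eq0 reslift_id => /eqP.
  by rewrite (z _ _ hs) (z _ _ ht) !mulr0 addr0 oppr0 w0 (psi_lo chi2M chi3N) ?mulr1.
rewrite /L_.
under eq_bigr do under eq_bigr do under eq_bigr do rewrite dE.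
under eq_bigr do under eq_bigr do rewrite -natr_sum.
under eq_bigr do rewrite -natr_sum.
rewrite -natr_sum pnatr_eq0 -lt0n.
have B0 : B 0 0 0.
  have z j : unif k ^+ j * reslift 0 \in inP j.+1.
    by rewrite -[j.+1]addn1 inPXD -res_eq0 reslift_id.
  rewrite /B /rep3 lo_box !z /=; have := z lev20 => hz; by inP_tac.
by rewrite (bigD1 0) //= (bigD1 0) //= (bigD1 0) //= B0.
Qed.

End Projection.

(** * Finite Fourier analysis on the residue field *)

Section Fourier.
Variables (kF : finFieldType) (F : numFieldType) (w : kF -> F).
Hypotheses (w0 : w 0 = 1) (wD : forall a b, w (a + b) = w a * w b)
  (w_nt : exists a, w a != 1).
Local Notation q := (#|{: kF}|%:R : F).

(** The sum over all characters is q g(0) by orthogonality, and the trivial one contributes the sum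
    of g. *)
Lemma nontrivial_characters_sum (g : kF -> F) :
  \sum_(a | a != 0) \sum_s w (- (a * s)) * g s = q * g 0 - \sum_s g s.
Proof.
rewrite exchange_big /=.
have E s : \sum_(a | a != 0) w (- (a * s)) * g s =
   (if s == 0 then q else 0) * g s - g s.
  rewrite -mulr_suml -[X in _ = _ - X]mul1r -mulrBl; congr (_ * _).
  have := w_sum w0 wD w_nt (- s); rewrite oppr_eq0 => <-.
  rewrite [X in _ = X - _](bigD1 0) //= mulr0 w0 addrAC subrr add0r.
  by apply: eq_bigr => a _; rewrite mulNr mulrC.
rewrite (eq_bigr _ (fun s _ => E s)) sumrB; congr (_ - _).
rewrite (bigD1 0) //= eqxx big1 ?addr0 // => s /negPf->.
by rewrite mul0r.
Qed.

(** Fourier inversion at s, where only the trivial character contributes: g is constant. *)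
Lemma constant_of_fourier (g : kF -> F) s :
  (forall a, a != 0 -> \sum_s w (- (a * s)) * g s = 0) -> q * g s = \sum_s g s.
Proof.
move=> g0.
have : \sum_(a | a != 0) w (a * s) * (\sum_s w (- (a * s)) * g s) = 0.
  by apply: big1 => a a0; rewrite g0 ?mulr0.
have /= := nontrivial_characters_sum (fun t => g (t + s)).
rewrite add0r => e.
set X := (X in X = 0 -> _).
have -> : X = \sum_(a | a != 0) \sum_t w (- (a * t)) * g (t + s).
  apply: eq_bigr => a _; rewrite mulr_sumr (reindex_inj (addIr s)) /=.
  apply: eq_bigr => t _; rewrite mulrA -wD; congr (w _ * _).
  by ring.
rewrite e => /eqP; rewrite subr_eq0 => /eqP->.
by rewrite [RHS](reindex_inj (addIr s)).
Qed.

(** The one-variable formula in each variable, an inclusion-exclusion between values at 0 and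
    sums. *)
Lemma nontrivial_characters_sum2 (g : kF -> kF -> F) :
  \sum_(a | a != 0) \sum_(b | b != 0) \sum_s \sum_t w (- (a * s + b * t)) * g s t =
  q * (q * g 0 0 - \sum_t g 0 t) - \sum_s (q * g s 0 - \sum_t g s t).
Proof.
rewrite -(nontrivial_characters_sum (fun s => q * g s 0 - \sum_t g s t)).
apply: eq_bigr => a _; rewrite exchange_big /=; apply: eq_bigr => s _.
rewrite -nontrivial_characters_sum mulr_sumr; apply: eq_bigr => b _.
by rewrite mulr_sumr; apply: eq_bigr => t _; rewrite opprD wD mulrA.
Qed.

End Fourier.

(** * The kernel of L for m > 0 *)

Section KernelPos.
Variables (k : padicField) (F : numFieldType) (chi2 chi3 : k -> F) (M N : nat).
Hypotheses (chi2_char : is_character chi2) (chi3_char : is_character chi3).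
Hypotheses (chi2M : forall x, x \in unit_filtration M -> chi2 x = 1).
Hypotheses (chi3N : forall x, x \in unit_filtration N -> chi3 x = 1).
Hypotheses (leMN : (M <= N)%N) (N_gt0 : (0 < N)%N).
Notation R := (integers k).
Notation K := (GL3 k).
Notation kF := (residue_field k).
Notation res := (residue k).
Notation psi := (chi_c chi2 chi3 M).

Variables (m n : nat) (w : kF -> F).
Hypotheses (leMm : (M <= m)%N) (leNn : (N <= n)%N).
Hypotheses (w0 : w 0 = 1) (wD : forall a b, w (a + b) = w a * w b)
  (w_nt : exists a, w a != 1).

Notation Hgrp := (@Hgrp k m n).
Notation theta := (theta chi2 chi3 M m n w).
Notation lev20 := (lev20 m n).
Notation lev01 := (lev01 m).
Notation top := (maxn n.+1 m.+1).

Local Notation L_ := (L_ m n w).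
Local Notation q := (#|{: kF}|%:R : F).
Local Notation rep3 := (rep3 m n).

Hypothesis m_gt0 : (0 < m)%N.

(** Here lev20 is the level of C_c, so f does not see r and [L_ a b] is q times a Fourier
    coefficient in (s, t). Summing those with a and b nonzero gives q^2 f - q av21 f - q av10 f +
    av10 (av21 f) = 0, and each average belongs to a smaller U_d. *)
Lemma kernel_L_pos f :
  equivariant (box m.+1 n.+1 top 0) psi f -> smooth f ->
  (forall x, L_ 1 1 f x = 0) ->
  exists f1 f2 : K -> F,
    [/\ equivariant (box m.+1 n top 0) psi f1 /\ smooth f1,
        equivariant (box m n.+1 top 0) psi f2 /\ smooth f2
      & forall x, f x = f1 x + f2 x].
Proof.
move=> fC fs Lf; have lb := lev_bounds leMN N_gt0 leMm leNn.
have levE : lev20 = top by rewrite /lev20; case: eqP => // m0; lia.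
have q0 : q != 0 by exact: card_kF_neq0.
have z j : unif k ^+ j * reslift 0 \in inP j.+1.
  by rewrite -[j.+1]addn1 inPXD -res_eq0 reslift_id.
have Lab a b x : a != 0 -> b != 0 -> L_ a b f x = 0.
  move=> a0 b0.
  exact: (L_torus chi2_char chi3_char chi2M chi3N leMN N_gt0 leMm leNn fC a0 b0 Lf).
pose h x s t := f (rep3 s 0 t * x)%g.
have hE x s r t : f (rep3 s r t * x)%g = h x s t.
  apply: (lo_cong chi2M chi3N leMN N_gt0 leMm leNn) => //.
  - by rewrite subrr inP0.
  - by rewrite subrr inP0.
  - by rewrite -mulrBr levE inPX.
  - exact: inPX.
have LE a b x : L_ a b f x = q * \sum_s \sum_t w (- (a * s + b * t)) * h x s t.
  rewrite mulr_sumr; apply: eq_bigr => s _.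
  under eq_bigr do under eq_bigr do rewrite hE.
  by rewrite sumr_const mulr_natl.
have main x : q * (q * h x 0 0 - \sum_t h x 0 t) -
    \sum_s (q * h x s 0 - \sum_t h x s t) = 0.
  rewrite -(nontrivial_characters_sum2 w0 wD w_nt).
  rewrite big1 // => a a0; rewrite big1 // => b b0.
  by apply: (mulfI q0); rewrite -LE Lab // mulr0.
have h00 x : h x 0 0 = f x.
  rewrite -[in RHS](mul1g x) -lo1.
  apply: (lo_cong chi2M chi3N leMN N_gt0 leMm leNn) => //;
    by rewrite ?subr0 ?z ?inP0 // levE (inPW _ (z _)).
have h0t x : \sum_t h x 0 t = av21 n f x.
  apply: eq_bigr => t _.
  apply: (lo_cong chi2M chi3N leMN N_gt0 leMm leNn) => //;
    by rewrite ?subr0 ?subrr ?z ?inP0 // levE (inPW _ (z _)).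
have hs0 x : \sum_s h x s 0 = av10 m f x.
  apply: eq_bigr => s _.
  apply: (lo_cong chi2M chi3N leMN N_gt0 leMm leNn) => //;
    by rewrite ?subr0 ?subrr ?z ?inP0 ?inPX ?levE //.
have hst x : \sum_s \sum_t h x s t = av10 m (av21 n f) x.
  apply: eq_bigr => s _; apply: eq_bigr => t _; rewrite mulgA loM.
  apply: (lo_cong chi2M chi3N leMN N_gt0 leMm leNn) => //;
    rewrite ?add0r ?addr0 ?subrr ?inP0 ?inPX //.
  apply: inPB; first by rewrite levE (inPW _ (z _)).
  have a1 : unif k ^+ n * reslift t \in inP n by exact: inPX.
  have a2 : unif k ^+ m * reslift s \in inP m by exact: inPX.
  by inP_tac.
have E21 : equivariant (box m.+1 n top 0) psi (av21 n f).
  by apply: (av21_equivariant chi2_char chi3_char chi2M chi3N leMN N_gt0) => //; lia.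
have s21 := smooth_av21 n fs.
have E10 g : equivariant (box m.+1 n.+1 top 0) psi g ->
    equivariant (box m n.+1 top 0) psi (av10 m g).
  move=> gE.
  by apply: (av10_equivariant chi2_char chi3_char chi2M chi3N leMN N_gt0) => //; lia.
have E21' : equivariant (box m.+1 n.+1 top 0) psi (av21 n f).
  by apply: equivariant_box_le E21; split.
(* The relation [main] solved for f; the zero term only gives the first summand the shape required
   by [smooth_lin]. *)
exists (fun x => q^-1 * av21 n f x + 0 * f x),
  (fun x => q^-1 * av10 m f x + - (q^-1 * q^-1) * av10 m (av21 n f) x).
split.
- split; last exact: smooth_lin.
  by move=> g x gB; rewrite E21 // !mul0r !addr0 mulrCA.
- split; last by apply: smooth_lin; exact: smooth_av10.
  by move=> g x gB; rewrite (E10 _ fC) // (E10 _ E21') //; ring.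
- move=> x; have := main x; rewrite h00 h0t.
  rewrite sumrB hst -mulr_sumr hs0 => e.
  apply: (mulfI (mulf_neq0 q0 q0)); apply/eqP; rewrite -subr_eq0; apply/eqP.
  by rewrite -[RHS]e; field; rewrite q0.
Qed.

End KernelPos.

(** * The kernel of L for m = 0 *)

Section KernelZero.
Variables (k : padicField) (F : numFieldType) (chi2 chi3 : k -> F) (M N : nat).
Hypotheses (chi2_char : is_character chi2) (chi3_char : is_character chi3).
Hypotheses (chi2M : forall x, x \in unit_filtration M -> chi2 x = 1).
Hypotheses (chi3N : forall x, x \in unit_filtration N -> chi3 x = 1).
Hypotheses (leMN : (M <= N)%N) (N_gt0 : (0 < N)%N).
Notation R := (integers k).
Notation K := (GL3 k).
Notation kF := (residue_field k).
Notation res := (residue k).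
Notation psi := (chi_c chi2 chi3 M).
Local Notation q := (#|{: kF}|%:R : F).

Variables (n : nat) (w : kF -> F).
Hypotheses (leM0 : (M <= 0)%N) (leNn : (N <= n)%N).
Hypotheses (w0 : w 0 = 1) (wD : forall a b, w (a + b) = w a * w b)
  (w_nt : exists a, w a != 1).

Let topE : maxn n.+1 1 = n.+1. Proof. by apply/maxn_idPl. Qed.
Let lev20E : lev20 0 n = n. Proof. by []. Qed.

Let psi_eta3 (g : K) : psi g = eta3 chi3 (ent g 2 2).
Proof.
rewrite psiE /eta2; have -> : M == 0%N by rewrite -leqn0.
by rewrite mul1r.
Qed.

Let eta3_1' : eta3 chi3 (1 : R) = 1. Proof. exact: eta3_1 N_gt0. Qed.

Let refl0 j : unif k ^+ j * reslift 0 \in inP j.+1.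
Proof. by rewrite -[j.+1]addn1 inPXD -res_eq0 reslift_id. Qed.

(** The argument for m = 0 uses the action of the upper left 2 by 2 block, through [upper], [torus],
    [swap] and [lo s 0 0], on the pairs (r, t) in the last row. *)
Definition bottom (r t : kF) : K :=
  lo 0 (unif k ^+ n * reslift r) (unif k ^+ n * reslift t).

Definition upper (c : R) : K := GL3_of 1 c 0 0 1 0 0 0 1.
Definition torus (a b : R) : K := GL3_of a 0 0 0 b 0 0 0 1.
Definition swap : K := GL3_of 0 1 0 1 0 0 0 0 1.

Arguments upper c%_R.
Arguments torus (a b)%_R.

Let upperE c (A := ent (upper c)) :
  ((A 0 0 = 1) * (A 0 1 = c) * (A 0 2 = 0) *
   (A 1 0 = 0) * (A 1 1 = 1) * (A 1 2 = 0) *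
   (A 2 0 = 0) * (A 2 1 = 0) * (A 2 2 = 1))%type.
Proof.
apply: ent_GL3_of; set x := (X in X \is a _).
by have -> : x = 1; [rewrite /x; ring|exact: unitr1].
Qed.

Let torusE a b (A := ent (torus a b)) : a \is a GRing.unit -> b \is a GRing.unit ->
  ((A 0 0 = a) * (A 0 1 = 0) * (A 0 2 = 0) *
   (A 1 0 = 0) * (A 1 1 = b) * (A 1 2 = 0) *
   (A 2 0 = 0) * (A 2 1 = 0) * (A 2 2 = 1))%type.
Proof.
move=> aU bU; apply: ent_GL3_of; set x := (X in X \is a _).
by have -> : x = a * b; [rewrite /x; ring|rewrite unitrM aU].
Qed.

Let swapE (A := ent swap) :
  ((A 0 0 = 0) * (A 0 1 = 1) * (A 0 2 = 0) *
   (A 1 0 = 1) * (A 1 1 = 0) * (A 1 2 = 0) *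
   (A 2 0 = 0) * (A 2 1 = 0) * (A 2 2 = 1))%type.
Proof.
apply: ent_GL3_of; set x := (X in X \is a _).
by have -> : x = - 1; [rewrite /x; ring|exact: unitrN1].
Qed.

Let swapK : (swap * swap)%g = 1%g.
Proof. by apply: ent_ext9; rewrite entM !swapE ent1 /=; ring. Qed.

Section Function.
Variable f : K -> F.
Hypothesis fC : equivariant (box 1 n.+1 n.+1 0) psi f.
Hypothesis fs : smooth f.
Hypothesis Lf : forall x, L_ 0 n w 1 1 f x = 0.

Let fC' : equivariant (box 1 n.+1 (maxn n.+1 1) 0) psi f.
Proof. by rewrite topE. Qed.

Let f_cong x (s r t s' r' t' : R) :
  s - s' \in inP 1 -> t - t' \in inP n.+1 -> r - r' \in inP n.+1 ->
  f (lo s r t * x)%g = f (lo s' r' t' * x)%g.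
Proof.
move=> hs ht hr.
apply: (@lo_cong _ _ _ _ _ _ chi2M chi3N leMN N_gt0 0 n leM0 leNn) => //;
  rewrite ?topE //.
exact: inP_0.
Qed.

Let bottom_res x (r t : R) :
  f (lo 0 (unif k ^+ n * r) (unif k ^+ n * t) * x)%g = f (bottom (res r) (res t) * x)%g.
Proof.
have P j (z : R) : unif k ^+ j * z - unif k ^+ j * reslift (res z) \in inP j.+1.
  by rewrite -mulrBr -[j.+1]addn1 inPXD -res_eq reslift_id.
by apply: f_cong; rewrite ?subrr ?inP0.
Qed.

(** The Fourier coefficient of f along the last row at the character (a, b) of (r, t). *)
Definition G_ (a b : kF) (x : K) : F :=
  \sum_t \sum_r w (- (a * r + b * t)) * f (bottom r t * x)%g.

(** For b nonzero, [L_torus] makes all nontrivial Fourier coefficients in s vanish, so the sum does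
    not depend on s. The shear of r by s t is harmless because the character is trivial in r. *)
Let G_lower b (s : R) x : b != 0 -> G_ 0 b (lo s 0 0 * x)%g = G_ 0 b x.
Proof.
move=> b0.
pose h s := \sum_r \sum_t w (- (b * t)) * f (rep3 0 n s r t * x)%g.
have GE s' : G_ 0 b (lo s' 0 0 * x)%g = h (res s').
  rewrite /G_ /h [RHS]exchange_big /=; apply: eq_bigr => t _.
  rewrite [RHS](reindex_inj (addIr (res s' * t))) /=; apply: eq_bigr => r _.
  rewrite mul0r add0r; congr (_ * _); rewrite mulgA loM.
  have := rep3_res chi2M chi3N leMN N_gt0 leM0 leNn x s'
    (reslift r + s' * reslift t) (reslift t) fC'.
  rewrite rmorphD rmorphM !reslift_id => <-; rewrite lev20E expr0 mul1r.
  by congr (f (lo _ _ _ * x)%g); ring.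
have hc s' : q * h s' = \sum_s h s.
  apply: (constant_of_fourier w0 wD w_nt) => a a0.
  have := L_torus chi2_char chi3_char chi2M chi3N leMN N_gt0 leM0 leNn fC' a0 b0 Lf x.
  move=> e; rewrite -[RHS]e; apply: eq_bigr => u _; rewrite mulr_sumr.
  apply: eq_bigr => r _.
  rewrite mulr_sumr; apply: eq_bigr => t _.
  by rewrite mulrA opprD wD.
rewrite -[x in RHS]mul1g -lo1 !GE.
by apply: (mulfI (card_kF_neq0 kF F)); rewrite !hc.
Qed.

(** Translation by [upper c] shears (r, t), hence dually the character. *)
Let G_upper b (c : R) x : G_ 0 b (upper c * x)%g = G_ (- (b * res c)) b x.
Proof.
rewrite /G_ exchange_big [RHS]exchange_big /=; apply: eq_bigr => r _.
rewrite [RHS](reindex_inj (addIr (r * res c))) /=; apply: eq_bigr => t _.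
congr (w _ * _); first by ring.
have up : upper c \in box 1 n.+1 n.+1 0.
  by apply/boxP; rewrite !upperE !inP0 inP_0.
have := bottom_res x (reslift r) (reslift t + reslift r * c).
rewrite rmorphD rmorphM !reslift_id => <-.
have p1 : psi (upper c) = 1 by rewrite psi_eta3 upperE.
rewrite -[RHS]mul1r -p1 -fC // !mulgA; congr (f (_ * x)%g).
by apply: ent_ext9; rewrite !entM !loE !upperE; ring.
Qed.

Let G_torus b (a' b' : R) x : a' \is a GRing.unit -> b' \is a GRing.unit ->
  G_ 0 b (torus a' b' * x)%g = G_ 0 (b / res b') x.
Proof.
move=> aU bU.
have a0 : res a' != 0 by rewrite -unit_res.
have b0 : res b' != 0 by rewrite -unit_res.
rewrite /G_ [RHS](reindex_inj (mulIf b0)) /=; apply: eq_bigr => t _.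
rewrite [RHS](reindex_inj (mulIf a0)) /=; apply: eq_bigr => r _.
congr (w _ * _); first by field.
have tE := torusE aU bU.
have tB : torus a' b' \in box 1 n.+1 n.+1 0.
  by apply/boxP; rewrite !tE !inP0.
have := bottom_res x (reslift r * a') (reslift t * b').
rewrite !rmorphM !reslift_id => <-.
have p1 : psi (torus a' b') = 1 by rewrite psi_eta3 tE.
rewrite -[RHS]mul1r -p1 -fC // !mulgA; congr (f (_ * x)%g).
by apply: ent_ext9; rewrite !entM !loE !tE; ring.
Qed.

(** [G_upper] reaches (a, b) from (0, b), where [G_lower] applies. The identity lo upper = torus
    upper swap, a Bruhat decomposition in the 2 by 2 block, then brings in [swap]. *)
Let G_swap a b x : a != 0 -> b != 0 -> G_ a b x = G_ b a (swap * x)%g.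
Proof.
move=> a0 b0; pose c := reslift (- (a / b)).
have ab0 : a / b != 0 by rewrite mulf_neq0 ?invr_eq0.
have rc : res c = - (a / b) by rewrite reslift_id.
have cU : c \is a GRing.unit by rewrite unit_res rc oppr_eq0.
have rV : res c^-1 = - (b / a) by rewrite rmorphV // rc invrN invf_div.
have VU : c^-1 \is a GRing.unit by rewrite unitrV.
have NU : - c^-1 \is a GRing.unit by rewrite unitrN.
have -> : a = - (b * res c) by rewrite rc; field.
rewrite -G_upper -(G_lower (- c^-1)) //.
have -> : (lo (- c^-1) 0 0 * (upper c * x) =
           torus c (- c^-1) * (upper c^-1 * (swap * x)))%g.
  rewrite !mulgA; congr (_ * x)%g.
  have tE := torusE cU NU.
  by apply: ent_ext9; rewrite !entM !tE !loE !upperE !swapE;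
     rewrite ?(mul0r, mulr0, mul1r, mulr1, addr0, add0r) ?mulNr ?mulVr ?mulrV ?addNr.
rewrite G_torus // G_upper; congr (G_ _ _ _).
  by rewrite rmorphN rV; field; rewrite ?opprK ?oppr_eq0 ?a0 ?b0.
by rewrite rmorphN rV rc; field; rewrite ?opprK ?oppr_eq0 ?a0 ?b0.
Qed.

(* [f x - q^-1 * av21 n f x - J_ x] collects the coefficients [G_ a b] with [a] and
   [b] nonzero, and is invariant under [swap].  As [J_] is invariant under lower
   unipotent matrices, [fun x => J_ (swap * x)] is in U_(1, n, n+1), and adding it
   to [f - q^-1 * av21 n f] gives a function invariant under [swap]. *)
Definition J_ x := q^-1 * q^-1 * \sum_(b | b != 0) G_ 0 b x.

Let q0 : q != 0. Proof. exact: card_kF_neq0. Qed.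

Let bottom_00 x : f (bottom 0 0 * x)%g = f x.
Proof.
by rewrite -[in RHS](mul1g x) -lo1; apply: f_cong; rewrite ?subr0 ?refl0 ?inP0.
Qed.

Let av21_bottom x : av21 n f x = \sum_t f (bottom 0 t * x)%g.
Proof.
apply: eq_bigr => t _.
by apply: f_cong; rewrite ?subrr ?sub0r ?inPN ?refl0 ?inP0.
Qed.

Let av20_bottom x : av20 n f x = \sum_r f (bottom r 0 * x)%g.
Proof.
apply: eq_bigr => t _.
by apply: f_cong; rewrite ?subrr ?sub0r ?inPN ?refl0 ?inP0.
Qed.

Let av_bottom x : av20 n (av21 n f) x = \sum_r \sum_t f (bottom r t * x)%g.
Proof.
apply: eq_bigr => r _; apply: eq_bigr => t _; rewrite mulgA loM.
by congr (f (lo _ _ _ * x)%g); ring.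
Qed.

Let J_average x :
  J_ x = q^-1 * av20 n f x + - (q^-1 * q^-1) * av20 n (av21 n f) x.
Proof.
rewrite /J_ (_ : \sum_(b | b != 0) G_ 0 b x = q * av20 n f x - av20 n (av21 n f) x).
  by field.
rewrite av20_bottom av_bottom [in RHS]exchange_big /=.
rewrite -(nontrivial_characters_sum w0 wD w_nt (fun t => \sum_r f (bottom r t * x)%g)).
apply: eq_bigr => b _; apply: eq_bigr => t _; rewrite mulr_sumr.
by apply: eq_bigr => r _; rewrite mul0r add0r.
Qed.

Let sum_G x : \sum_(a | a != 0) \sum_(b | b != 0) G_ a b x =
  q * q * (f x - q^-1 * av21 n f x - J_ x).
Proof.
have := nontrivial_characters_sum2 w0 wD w_nt (fun r t => f (bottom r t * x)%g).
rewrite -av21_bottom bottom_00 sumrB -mulr_sumr -av20_bottom -av_bottom => e.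
transitivity (q * (q * f x - av21 n f x) - (q * av20 n f x - av20 n (av21 n f) x)).
  rewrite -e; apply: eq_bigr => a _; apply: eq_bigr => b _.
  by rewrite /G_ exchange_big.
by rewrite J_average; field.
Qed.

Let sum_G_swap x : f (swap * x)%g - q^-1 * av21 n f (swap * x)%g - J_ (swap * x)%g =
  f x - q^-1 * av21 n f x - J_ x.
Proof.
apply: (mulfI (mulf_neq0 q0 q0)); rewrite -!sum_G [RHS]exchange_big /=.
apply: eq_bigr => a a0; apply: eq_bigr => b b0.
by rewrite [RHS]G_swap.
Qed.

(** The average [av20] brings the entry (2,0) to level n while (2,1) stays at n+1; for these levels
    to define a group, the entry (0,1) must lie in p. *)
Let J_equivariant1 : equivariant (box 1 n.+1 n 1) psi J_.
Proof.
have E1 : equivariant (box 1 n.+1 n 1) psi (av20 n f).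
  apply: (av20_equivariant chi2_char chi3_char chi2M chi3N leMN N_gt0); try lia.
  by apply: equivariant_box_le fC; split.
have E2 : equivariant (box 1 n n 0) psi (av20 n (av21 n f)).
  apply: (av20_equivariant chi2_char chi3_char chi2M chi3N leMN N_gt0); try lia.
  by apply: (av21_equivariant chi2_char chi3_char chi2M chi3N leMN N_gt0); try lia.
have E3 : equivariant (box 1 n.+1 n 1) psi (av20 n (av21 n f)).
  by apply: equivariant_box_le E2; split.
by move=> h x hB; rewrite !J_average E1 // E3 //; ring.
Qed.

Let J_equivariant : equivariant (box 0 n.+1 n 1) psi J_.
Proof.
move=> h x hB; have [|||u0 u1 u2] := box_unit _ _ _ hB; [lia|lia|lia|].
(* Right multiplication by [lo (- s) 0 0] clears the entry (1,0) of h, and [G_lower] shows that [J_]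
   ignores the remaining factor [lo s 0 0]. *)
pose s := (ent h 1 1)^-1 * ent h 1 0.
have -> : (h * x = h * lo (- s) 0 0 * (lo s 0 0 * x))%g.
  rewrite -!mulgA [(lo (- s) 0 0 * _)%g]mulgA loM addNr mul0r !addr0.
  by rewrite lo1 mul1g.
have [h1 h2 h3 h4] := boxP _ _ _ _ _ hB.
rewrite J_equivariant1; last first.
  apply/boxP; rewrite !entM !loE; split; try by inP_tac.
  by rewrite mulr1 mulr0 addr0 mulrN /s mulVKr // subrr inP0.
rewrite !psi_eta3 entM !loE !mulr0 mulr1 !add0r; congr (_ * _).
rewrite /J_; congr (_ * _); apply: eq_bigr => b b0.
exact: G_lower.
Qed.

Let swap_box h : h \in box 1 n n.+1 0 -> (swap * h * swap)%g \in box 0 n.+1 n 1.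
Proof.
move=> /boxP[h1 h2 h3 h4]; apply/boxP; rewrite !entM !swapE.
by rewrite !(mul0r, mulr0, mul1r, mulr1, addr0, add0r) !inP_0; split.
Qed.

(** The function f1 has levels (1, n, n+1), by [av21] and by conjugating [J_] with [swap]. The
    remainder f2 is equivariant at levels (1, n+1, n+1) and invariant under [swap], which together
    give equivariance at levels (0, n+1, n+1). *)
Lemma kernel_L_zero_decomposition : exists f1 f2 : K -> F,
    [/\ equivariant (box 1 n n.+1 0) psi f1 /\ smooth f1,
        equivariant (box 0 n.+1 n.+1 0) psi f2 /\ smooth f2
      & forall x, f x = f1 x + f2 x].
Proof.
pose f1 x := q^-1 * av21 n f x + (-1) * J_ (swap * x)%g.
pose f2 x := 1 * f x + (-1) * f1 x.
have Js : smooth J_.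
  rewrite (_ : J_ = fun x =>
      q^-1 * av20 n f x + - (q^-1 * q^-1) * av20 n (av21 n f) x).
    by apply: smooth_lin; [exact: smooth_av20|exact/smooth_av20/smooth_av21].
  by apply/funext => x; rewrite J_average.
have f1s : smooth f1.
  by apply: smooth_lin; [exact: smooth_av21|exact: smooth_left].
have f1E : equivariant (box 1 n n.+1 0) psi f1.
  move=> h x hB; rewrite /f1.
  have aE : equivariant (box 1 n n.+1 0) psi (av21 n f).
    by apply: (av21_equivariant chi2_char chi3_char chi2M chi3N leMN N_gt0); try lia.
  rewrite aE //.
  have -> : (swap * (h * x) = (swap * h * swap) * (swap * x))%g.
    by rewrite -!mulgA [(swap * (swap * x))%g]mulgA swapK mul1g.
  rewrite J_equivariant ?swap_box //.
  have -> : psi (swap * h * swap)%g = psi h.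
    rewrite !psi_eta3 !entM !swapE.
    by rewrite !(mul0r, mulr0, mul1r, mulr1, addr0, add0r).
  by ring.
have f2C : equivariant (box 1 n.+1 n.+1 0) psi f2.
  have f1C : equivariant (box 1 n.+1 n.+1 0) psi f1.
    by apply: equivariant_box_le f1E; split.
  by move=> h x hB; rewrite /f2 fC // f1C //; ring.
have f2swap x : f2 (swap * x)%g = f2 x.
  have := sum_G_swap x; rewrite /f2 /f1 mulgA swapK mul1g => /eqP.
  rewrite -subr_eq0 => /eqP e; apply/eqP; rewrite -subr_eq0 -[X in _ == X]e.
  by apply/eqP; ring.
exists f1, f2; split=> //; last by move=> x; rewrite /f2; ring.
split; last by exact: smooth_lin.
move=> h x hB; have [h1 h2 h3 h4] := boxP _ _ _ _ _ hB.
have [p1|hU] := inP1_or_unit (ent h 1 0).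
  by apply: f2C; apply/boxP; split.
(* Chosen to make the entry (0,0) of [upper a * h] vanish; [swap] moves it to (1,0), so that c lies
   in the box where [f2C] applies. *)
pose a := - ((ent h 1 0)^-1 * ent h 0 0).
pose c := (swap * (upper a * h))%g.
have uB b : upper b \in box 1 n.+1 n.+1 0.
  by apply/boxP; rewrite !upperE !inP0 inP_0.
have f2u b y : f2 (upper b * y)%g = f2 y.
  by rewrite (f2C _ _ (uB b)) psi_eta3 upperE eta3_1' mul1r.
rewrite -(f2u a) -f2swap (_ : (swap * (upper a * (h * x)) = c * x)%g); last first.
  by rewrite /c !mulgA.
rewrite f2C.
  congr (_ * _); rewrite !psi_eta3 /c !entM !swapE !upperE.
  by rewrite !(mul0r, mulr0, mul1r, mulr1, addr0, add0r).
apply/boxP; rewrite /c !entM !swapE !upperE.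
rewrite !(mul0r, mulr0, mul1r, mulr1, addr0, add0r); split=> //; last exact: inP_0.
by rewrite /a mulNr mulrC mulVKr // subrr inP0.
Qed.

End Function.

Lemma kernel_L_zero f :
  equivariant (box 1 n.+1 (maxn n.+1 1) 0) psi f -> smooth f ->
  (forall x, L_ 0 n w 1 1 f x = 0) ->
  exists f1 f2 : K -> F,
    [/\ equivariant (box 1 n (maxn n.+1 1) 0) psi f1 /\ smooth f1,
        equivariant (box 0 n.+1 (maxn n.+1 1) 0) psi f2 /\ smooth f2
      & forall x, f x = f1 x + f2 x].
Proof. by rewrite topE; exact: kernel_L_zero_decomposition. Qed.

End KernelZero.

(** * Irreducibility *)

Section Irreducibility.
Variables (k : padicField) (F : numFieldType) (chi2 chi3 : k -> F) (M N : nat).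
Hypotheses (chi2_char : is_character chi2) (chi3_char : is_character chi3).
Hypotheses (chi2M : forall x, x \in unit_filtration M -> chi2 x = 1).
Hypotheses (chi3N : forall x, x \in unit_filtration N -> chi3 x = 1).
Hypotheses (leMN : (M <= N)%N) (N_gt0 : (0 < N)%N).
Notation R := (integers k).
Notation K := (GL3 k).
Notation kF := (residue_field k).
Notation res := (residue k).
Notation psi := (chi_c chi2 chi3 M).

Variables (m n : nat) (w : kF -> F).
Hypotheses (leMm : (M <= m)%N) (leNn : (N <= n)%N).
Hypotheses (w0 : w 0 = 1) (wD : forall a b, w (a + b) = w a * w b)
  (w_nt : exists a, w a != 1).

Notation Hgrp := (@Hgrp k m n).
Notation theta := (theta chi2 chi3 M m n w).
Notation lev20 := (lev20 m n).
Notation lev01 := (lev01 m).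
Notation top := (maxn n.+1 m.+1).

Local Notation L_ := (L_ m n w 1 1).
Local Notation W_ := (fun_rep k F).

Lemma L_D (f g : W_) x : L_ (f + g) x = L_ f x + L_ g x.
Proof.
rewrite -big_split; apply: eq_bigr => s _; rewrite -big_split; apply: eq_bigr => r _.
rewrite -big_split; apply: eq_bigr => t _; exact: mulrDr.
Qed.

Lemma L_Z a (f : W_) x : L_ (a *: f) x = a * L_ f x.
Proof.
rewrite mulr_sumr; apply: eq_bigr => s _; rewrite mulr_sumr; apply: eq_bigr => r _.
rewrite mulr_sumr; apply: eq_bigr => t _; exact: mulrCA.
Qed.

Lemma L_0 x : L_ (0 : W_) x = 0.
Proof. by rewrite -(scale0r (0 : W_)) L_Z mul0r. Qed.

Lemma L_sum (I : finType) (f : I -> W_) x : L_ (\sum_i f i) x = \sum_i L_ (f i) x.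
Proof.
by apply: (big_morph (fun g : W_ => L_ g x)) => [g h|]; [exact: L_D|exact: L_0].
Qed.

Lemma L_act (g : K) (f : W_) x : L_ (rep_act g f) x = L_ f (x * g)%g.
Proof.
apply: eq_bigr => s _; apply: eq_bigr => r _; apply: eq_bigr => t _.
by rewrite mulgA.
Qed.

Lemma L_right_smooth l (f : K -> F) :
  (forall x g, g \in congruence_subgroup l -> f (x * g)%g = f x) ->
  forall x g, g \in congruence_subgroup l -> L_ f (x * g)%g = L_ f x.
Proof.
move=> fl x g gl.
apply: eq_bigr => s _; apply: eq_bigr => r _; apply: eq_bigr => t _.
by rewrite mulgA (fl _ g gl).
Qed.

Lemma congruenceP l (g : K) : reflect
  (forall i j, ent g i j - (if i == j then 1 else 0) \in inP l)
  (g \in congruence_subgroup l).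
Proof.
have E (i j : 'I_3) : (ent g i j - (if i == j then 1 else 0) \in inP l) =
    (entry g i j - (i == j)%:R \in idealpow l).
  by rewrite [LHS]unfold_in /inP /=; case: (i == j).
apply: (iffP idP) => [/forallP gl i j|gl].
  by rewrite E; exact: forallP (gl i) j.
by apply/forallP => i; apply/forallP => j; rewrite -E.
Qed.

Lemma congruence_div l (x y : K) :
  (forall i j, ent x i j - ent y i j \in inP l) ->
  (x * y^-1)%g \in congruence_subgroup l.
Proof.
move=> xy; apply/congruenceP => i j.
have -> : (if i == j then 1 else 0) = ent (y * y^-1)%g i j by rewrite mulgV ent1.
rewrite !entM.
set a := ent y^-1%g; set z := (X in X \in _).
have -> : z = (ent x i 0 - ent y i 0) * a 0 j + (ent x i 1 - ent y i 1) * a 1 j +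
   (ent x i 2 - ent y i 2) * a 2 j by rewrite /z; ring.
by do !apply: inPD; apply: inPMr.
Qed.

Lemma congruence_is_subgroup l : is_subgroup (@congruence_subgroup k l).
Proof.
split=> [|x y /congruenceP xl /congruenceP yl].
  by apply/congruenceP => i j; rewrite ent1 subrr inP0.
apply: congruence_div => i j.
rewrite -(subrK (if i == j then 1 else 0) (ent x i j)) -addrA inPD // -opprB inPN.
exact: yl.
Qed.

(** A finite invariant that determines g modulo the congruence subgroup of level l. *)
Definition digits l (g : K) : {ffun 'I_3 * 'I_3 * 'I_l -> kF} :=
  [ffun p : 'I_3 * 'I_3 * 'I_l => digit p.2 (ent g p.1.1 p.1.2)].

Lemma digits_eq l (x y : K) : digits l x = digits l y ->
  (x * y^-1)%g \in congruence_subgroup l.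
Proof.
move=> /ffunP e; apply: congruence_div => i j; apply: digit_inj => a al.
by have := e (i, j, Ordinal al); rewrite !ffunE.
Qed.

Lemma congruence_Hgrp l g : (top <= l)%N -> g \in congruence_subgroup l ->
  g \in Hgrp /\ theta g = 1.
Proof.
move=> tl gl; have lb := lev_bounds leMN N_gt0 leMm leNn.
have [/boxP[g1 g2 g3 g4] pg] := congruence_box chi2M chi3N leMN N_gt0 leMm leNn tl gl.
have gE := congruenceP _ _ gl.
have := gE 0 1; have := gE 0 0; have := gE 1 1; have := gE 2 2.
rewrite /= subr0 => g22 g11 g00 g01; split; last first.
  rewrite /theta pg !coef_small //; try by inP_tac.
  by rewrite !mul0r addr0 w0 mulr1.
have E (a b : R) : a - b = (a - 1) - (b - 1) by ring.
by apply/HgrpP; split; split; [..|rewrite E|rewrite E]; inP_tac.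
Qed.

(** If d <= c in T has d_1 = m+1 and d_2 = n+1, then d_3 is at least their maximum and d = c. So d <
    c forces d_1 <= m or d_2 <= n, and one of the vanishing lemmas applies. *)
Lemma L_U_sum (f : W_) x :
  f \in sum_subrep (fun d => in_Tm M N d /\ triple_lt d (Triple m.+1 n.+1 top))
     (U_ chi2 chi3 M) -> L_ f x = 0.
Proof.
have lb := lev_bounds leMN N_gt0 leMm leNn.
move=> /asboolP[s sU ->]; elim: s sU => [|u s IHs] sU; first by rewrite big_nil L_0.
rewrite big_cons L_D IHs ?addr0; last by move=> v vs; apply: sU; rewrite inE vs orbT.
have [d [[[t1 t2 t3] _] [[le1 le2 le3] ne]] /U_P[uE _]] := sU u (mem_head _ _).
rewrite /= in le1 le2 le3.
have [dm|dm] := leqP (tr1 d) m.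
  apply: (L_vanish_10 chi2M chi3N leMN N_gt0 leMm leNn w0 wD w_nt).
  by apply: equivariant_box_le uE; split.
have [dn|dn] := leqP (tr2 d) n.
  apply: (L_vanish_21 chi2M chi3N leMN N_gt0 leMm leNn w0 wD w_nt).
  by apply: equivariant_box_le uE; split.
case: ne; case: d {uE} t1 t2 t3 le1 le2 le3 dm dn => d1 d2 d3 /= *.
by congr Triple; lia.
Qed.

Lemma kernel_L (f : W_) : f \in U_ chi2 chi3 M (Triple m.+1 n.+1 top) ->
  (forall x, L_ f x = 0) ->
  f \in sum_subrep (fun d => in_Tm M N d /\ triple_lt d (Triple m.+1 n.+1 top))
     (U_ chi2 chi3 M).
Proof.
move=> /U_P[/= fE fs] Lf; have lb := lev_bounds leMN N_gt0 leMm leNn.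
suff [f1 [f2 [f1U f2U fE12]]] : exists f1 f2 : K -> F,
    [/\ equivariant (box m.+1 n top 0) psi f1 /\ smooth f1,
        equivariant (box m n.+1 top 0) psi f2 /\ smooth f2
      & forall x, f x = f1 x + f2 x].
  apply/asboolP; exists [:: f1; f2 : W_]; last first.
    rewrite big_cons big_cons big_nil addr0; apply/funext => x; exact: fE12.
  move=> u; rewrite !inE => /orP[/eqP->|/eqP->].
    exists (Triple m.+1 n top); last exact/U_P.
    by split; split=> //=; try split=> /=; try lia; case; lia.
  exists (Triple m n.+1 top); last exact/U_P.
  by split; split=> //=; try split=> /=; try lia; case; lia.
have [m0|m_gt0] := posnP m; last first.
  exact: (kernel_L_pos chi2_char chi3_char chi2M chi3N leMN N_gt0 leMm leNn w0 wD w_nt).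
move: leMm fE Lf; rewrite m0 => leM0 fE' Lf'.
exact: (kernel_L_zero chi2_char chi3_char chi2M chi3N leMN N_gt0 leM0 leNn w0 wD w_nt).
Qed.

Lemma theta1 : theta 1%g = 1.
Proof.
have gH := Hgrp_subgroup k leMN N_gt0 leMm leNn.
have [t0 tM] := theta_mult chi2_char chi3_char chi2M chi3N leMN N_gt0 leMm leNn w0 wD.
apply: (mulfI (t0 1%g gH.1)).
by rewrite -tM ?mulg1 ?mulr1 //; exact: gH.1.
Qed.

Lemma thetaV h : h \in Hgrp -> theta h^-1%g = (theta h)^-1.
Proof.
move=> hH; have gH := Hgrp_subgroup k leMN N_gt0 leMm leNn.
have [t0 tM] := theta_mult chi2_char chi3_char chi2M chi3N leMN N_gt0 leMm leNn w0 wD.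
apply: (mulfI (t0 h hH)); rewrite -tM ?mulgV ?theta1 ?divff ?t0 //.
exact: (subgroupV gH).
Qed.

(** Left averaging with the inverse character, applied to y -> g (x y^-1) over the cosets of a
    congruence subgroup fixing g, produces functions that transform on the right under H by
    theta. *)
Lemma right_average l : (top <= l)%N -> exists (I : nat) (r : 'I_I -> K),
  [/\ (0 < I)%N, forall i, r i \in Hgrp &
  forall g : K -> F, (forall x h, h \in congruence_subgroup l -> g (x * h)%g = g x) ->
    forall x h, h \in Hgrp ->
      \sum_i theta (r i) * g (x * h * (r i)^-1)%g =
      theta h * \sum_i theta (r i) * g (x * (r i)^-1)%g].
Proof.
move=> tl.
have gH := Hgrp_subgroup k leMN N_gt0 leMm leNn.
have gC := congruence_is_subgroup l.
have [t0 tM] := theta_mult chi2_char chi3_char chi2M chi3N leMN N_gt0 leMm leNn w0 wD.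
have [I [r rT]] := coset_transversal_exists (rho := digits l) gC gH
  (fun x y _ _ => @digits_eq l x y).
exists I, r; have [rH rC _] := rT; split=> //.
  by have [i _] := rC _ gH.1; exact: leq_ltn_trans (ltn_ord i).
move=> g gl x h hH.
pose psi' h := (theta h)^-1.
have psiM' : multiplicative_on Hgrp psi'.
  split=> [y yH|y z yH zH]; first by rewrite invr_eq0 t0.
  by rewrite /psi' tM // invfM.
have sub : {subset @congruence_subgroup k l <= Hgrp}.
  by move=> y /(congruence_Hgrp tl)[].
have gE : equivariant (@congruence_subgroup k l) psi' (fun y => g (x * y^-1)%g).
  move=> c y cC; have [_ tc] := congruence_Hgrp tl cC.
  rewrite /psi' tc invr1 mul1r invgM mulgA (gl _ _ (subgroupV gC cC)) //.
have := average_equivariant gC gH sub psiM' rT gE 1%g (subgroupV gH hH).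
rewrite /psi' thetaV // invrK => e.
transitivity (\sum_i (theta (r i))^-1^-1 * g (x * (r i * (h^-1 * 1))^-1)%g).
  by apply: eq_bigr => i _; rewrite invrK mulg1 invgM invgK mulgA.
by rewrite e; congr (_ * _); apply: eq_bigr => i _; rewrite invrK mulg1.
Qed.

Lemma V_irreducible :
  irreducible_rep (V_ chi2 chi3 M N (Triple m.+1 n.+1 top)).
Proof.
have gH := Hgrp_subgroup k leMN N_gt0 leMm leNn.
have [t0 tM] := theta_mult chi2_char chi3_char chi2M chi3N leMN N_gt0 leMm leNn w0 wD.
apply: irreducible_quot.
  exists (delta chi2 chi3 M m n : W_).
    apply/U_P; split.
      exact: (delta_equivariant chi2_char chi3_char chi2M chi3N leMN N_gt0 leMm leNn).
    exact: (delta_smooth chi2_char chi3_char chi2M chi3N leMN N_gt0 leMm leNn).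
  apply/negP => /(L_U_sum 1%g)/eqP.
  by rewrite (negPf (L_delta chi2M chi3N leMN N_gt0 leMm leNn w0)).
set S := sum_subrep _ _; set U := U_ _ _ _ _.
move=> T TU ST [v vT vS].
have LE (f : W_) : f \in U -> equivariant Hgrp theta (L_ f).
  move=> /U_P[fE _].
  exact: (L_equivariant chi2_char chi3_char chi2M chi3N leMN N_gt0 leMm leNn w0 wD).
have [x0 Lx0] : exists x0, L_ v x0 != 0.
  apply: contrapT => /forallNP Lv; move/negP: vS; apply.
  apply: kernel_L => [|x]; first exact: TU.
  by apply/eqP/negPn/negP; exact: Lv.
pose v1 : W_ := rep_act x0 v.
have v1T : v1 \in T by exact: subrep_act.
have Lv1 : L_ v1 1%g != 0 by rewrite L_act mul1g.
have [l0 v1l] : smooth v1 by have /U_P[] := TU _ v1T.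
pose l := maxn l0 top.
have [I [r [I0 rH rA]]] := right_average (leq_maxr l0 top).
(* The right average of a translate of v whose image under L is nonzero at 1; L v2 transforms by
   theta on both sides. *)
pose v2 : W_ := \sum_i theta (r i) *: rep_act (r i)^-1%g v1.
have v2T : v2 \in T by apply: rpred_sum => i _; apply: rpredZ; exact: subrep_act.
have Lv2E x : L_ v2 x = \sum_i theta (r i) * L_ v1 (x * (r i)^-1)%g.
  by rewrite L_sum; apply: eq_bigr => i _; rewrite L_Z L_act.
have Lv2r x h : h \in Hgrp -> L_ v2 (x * h)%g = theta h * L_ v2 x.
  move=> hH; rewrite !Lv2E; apply: rA => //.
  apply: L_right_smooth => y g gl; apply: v1l.
  by apply: congruence_subgroup_le gl; exact: leq_maxl.
have Lv2l := LE _ (TU _ v2T).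
(* Left equivariance of L v1 makes all the terms equal, and their number is nonzero in
   characteristic 0. *)
have c0 : L_ v2 1%g != 0.
  rewrite Lv2E (eq_bigr (fun=> L_ v1 1%g)) => [|i _].
    by rewrite sumr_const card_ord -mulr_natr mulf_neq0 // pnatr_eq0 -lt0n.
  rewrite mul1g -[X in L_ v1 X]mulg1 (LE _ (TU _ v1T)); last exact: (subgroupV gH).
  by rewrite thetaV // mulVKf ?t0.
(* Where L v2 is nonzero at g, its two equivariances force theta h = theta h' whenever h g = g h',
   so g intertwines theta. *)
have Lv2supp g : L_ v2 g != 0 -> g \in Hgrp.
  move=> g0.
  apply: (intertwines_Hgrp chi3_char chi2M chi3N leMN N_gt0 leMm leNn w0 wD w_nt).
  move=> h h' hH h'H e; apply: (mulIf g0).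
  by rewrite -(Lv2l _ _ hH) e Lv2r.
have [J [s [_ sC sI]]] := coset_transversal_exists (C := Hgrp) (D := predT)
  (rho := digits top) gH (conj isT (fun _ _ _ _ => isT))
  (fun x y _ _ e => (congruence_Hgrp (leqnn top) (digits_eq e)).1).
move=> u uU.
(* The translates of L v2 used here are supported on the disjoint cosets H (s j), so this
   combination reproduces L u coset by coset and u - u1 lies in the kernel of L. *)
pose u1 : W_ := \sum_j (L_ u (s j) / L_ v2 1%g) *: rep_act (s j)^-1%g v2.
have u1T : u1 \in T by apply: rpred_sum => i _; apply: rpredZ; exact: subrep_act.
rewrite -(subrK u1 u) rpredD //; apply: ST; first by rewrite rpredB // TU.
apply: kernel_L => [|x]; first by rewrite rpredB // TU.
rewrite -scaleN1r L_D L_Z mulN1r; apply/eqP; rewrite subr_eq0; apply/eqP.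
have [j xj] := sC x isT.
rewrite L_sum (bigD1 j) //= big1 ?addr0 => [|i ij].
  rewrite L_Z L_act -[(x * (s j)^-1)%g]mulg1 (Lv2l _ _ xj) mulrCA divfK //.
  by rewrite -(LE _ uU _ _ xj) mulgVK.
rewrite L_Z L_act.
have [->|nz] := eqVneq (L_ v2 (x * (s i)^-1)%g) 0; first by rewrite mulr0.
case/eqP: ij; apply: sI.
have := subgroupM gH (subgroupV gH (Lv2supp _ nz)) xj.
by rewrite invgM invgK mulgA mulgVK.
Qed.

End Irreducibility.

(** * Existence of a nontrivial additive character *)

(** A root of 1 + X + ... + X^(p-1), whose value at 1 is p, nonzero in characteristic 0. *)
Lemma nontrivial_root_of_unity (C : numClosedFieldType) p :
  (1 < p)%N -> exists2 z : C, z ^+ p = 1 & z != 1.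
Proof.
move=> p1; have p0 : (0 < p.-1)%N by lia.
have [z zE] := solve_monicpoly (fun=> -1 : C) p0.
have sum0 : \sum_(i < p) z ^+ i = 0.
  rewrite -[p]prednK; last by lia.
  rewrite big_ord_recr /= zE -big_split big1 // => i _.
  by rewrite /= mulN1r ?subrr ?addNr.
exists z; first by apply/eqP; rewrite -subr_eq0 subrX1 sum0 mulr0.
apply/eqP => z1; move/eqP: sum0; apply/negP; rewrite z1.
under eq_bigr do rewrite expr1n.
by rewrite sumr_const card_ord pnatr_eq0; lia.
Qed.

(** A coordinate form over F_p that is nonzero at 1, followed by powers of a nontrivial p-th root of
    unity. *)
Lemma nontrivial_additive_character (C : numClosedFieldType) (L : finFieldType) p :
  p \in [pchar L] -> exists w : L -> C,
    [/\ w 0 = 1, forall a b, w (a + b) = w a * w b & exists a, w a != 1].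
Proof.
move=> pL; have p_pr := pcharf_prime pL.
have [z zp z1] := nontrivial_root_of_unity C (prime_gt1 p_pr).
pose V : vectType 'F_p := pPrimeCharType pL.
have one_nz : v2r (1 : pPrimeCharType pL) != 0.
  by rewrite -(linear0 v2r) (inj_eq (@v2r_inj _ _)) oner_eq0.
have [i ci] : exists i, v2r (1 : pPrimeCharType pL) 0 i != 0.
  by have /rV0Pn[i ci] := one_nz; exists i.
pose phi (a : pPrimeCharType pL) : 'F_p := v2r a 0 i.
exists (fun a => z ^+ phi a); split.
- by rewrite /phi linear0 mxE expr0.
- move=> a b; have -> : phi (a + b) = phi a + phi b by rewrite /phi linearD mxE.
  rewrite /= -exprD [X in (_ %% X)%N](Fp_cast p_pr).
  exact: expr_mod.
exists ((phi 1)^-1 *: (1 : pPrimeCharType pL)).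
have -> : phi ((phi 1)^-1 *: (1 : pPrimeCharType pL)) = 1.
  by rewrite /phi linearZ mxE mulVf.
by rewrite expr1.
Qed.

Theorem theorem4p3 (R : realType) (k : padicField) (p q : nat)
    (hp : p \in [pchar (residue_field k)]) (p_gt2 : (2 < p)%N)
    (hq : #|residue_field k| = q) (q_gt3 : (3 < q)%N)
    (chi2 chi3 : k -> R[i])
    (chi2_char : is_character chi2) (chi3_char : is_character chi3)
    (M N : nat)
    (condM : is_cond chi2 M) (condN : is_cond chi3 N)
    (leMN : (M <= N)%N) (N_gt0 : (0 < N)%N)
    (condMN : is_cond (fun x => chi2 x * (chi3 x)^-1) N)
    (m n : nat) (ltMm : (M < m)%N) (ltNn : (N < n)%N) :
  irreducible_rep (V_ chi2 chi3 M N (Triple m n (maxn n m))).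
Proof.
(* Both parameters exceed a natural number, hence are successors, which matches the shift by one in
   [V_irreducible]. *)
case: m ltMm => // m ltMm; case: n ltNn => // n ltNn.
have [w [w0 wD w_nt]] := nontrivial_additive_character R[i] hp.
exact: (V_irreducible chi2_char chi3_char condM.1 condN.1 leMN N_gt0 ltMm ltNn
  w0 wD w_nt).
Qed.
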